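(* Under the standing setup (Assumption A on $p,n,b$ and Assumption Z on $\{Z_j\}$), the empirical eigenvalue measure $L=L^{(p)}=p^{-1}\sum_{i=1}^p\delta_{\lambda_i^{(p)}}$ of the banded sample covariance matrix $Y=Y^{(p)}$ converges weakly to $\nu_Z$, in probability, as $p\to\infty$.
   Context: Joint cumulant: for real random variables $X_1,\dots,X_k$ with moments of all orders, $\mathbf C(X_1,\dots,X_k)=i^{-k}\frac{\partial^k}{\partial t_1\cdots\partial t_k}\log \mathbf E\exp(\sum_{j=1}^k i t_jX_j)\big|_{t=0}$. Assumption A: $p$ is a positive integer, $b=b(p)>0$ and $n=n(p)$ a positive integer depending on $p$; as $p\to\infty$, $b\to\infty$, $n\to\infty$, $b/n\to0$, and $b\le p$. Assumption Z: $\{Z_j\}_{j\in\mathbb Z}$ is a stationary sequence of real random variables with (1) $\mathbf E|Z_0|^k<\infty$ for all $k\ge1$, (2) $\mathbf EZ_0=0$, (3) $\sum_{j_1,\dots,j_r\in\mathbb Z}|\mathbf C(Z_0,Z_{j_1},\dots,Z_{j_r})|<\infty$ for all $r\ge1$. Matrices: let $\{\{Z^{(i)}_j\}_{j\in\mathbb Z}\}_{i\ge1}$ be i.i.d. copies of $\{Z_j\}$; $X$ is the $n\times p$ matrix with $X_{ij}=Z^{(i)}_j/\sqrt n$; $B$ is the $p\times p$ matrix with $B_{ij}=1$ if $|i-j|\le b$ and $0$ otherwise; $Y$ is the $p\times p$ symmetric matrix $Y_{ij}=B_{ij}(X^TX)_{ij}$, with eigenvalues $\lambda^{(p)}_1,\dots,\lambda^{(p)}_p$.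 Let $R(j)=\mathrm{Cov}(Z_0,Z_j)$, spectral density $f_Z(\theta)=\sum_{j\in\mathbb Z}e^{2\pi i j\theta}R(j)$ on $[0,1]$, and $\nu_Z=m\circ f_Z^{-1}$, where $m$ is Lebesgue measure on $[0,1]$ (equivalently $\int x^k\,\nu_Z(dx)=\int_0^1 f_Z(\theta)^k d\theta$ for all $k$). *)

(* Defs.v *)
From HB Require Import structures.
From mathcomp Require Import all_boot all_order all_algebra.
From mathcomp Require Import all_classical all_reals all_analysis.
Set Implicit Arguments. Unset Strict Implicit. Unset Printing Implicit Defensive.
Import Order.TTheory GRing.Theory Num.Theory.
Import numFieldNormedType.Exports.
Local Open Scope classical_set_scope.
Local Open Scope ring_scope.

Section Defs.
Context {d : measure_display} {T : measurableType d} {R : realType}.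
Variable P : probability T R.

(* real-valued expectation E[X] (used only for integrable X) *)
Definition Ex (X : T -> R) : R := fine (\int[P]_x (X x)%:E).

(* joint cumulant C(X_1,...,X_k), written out by the moment-cumulant
   (Leonov--Shiryaev) formula:
   sum over set partitions pi of {1..k} of
   (-1)^(|pi|-1) (|pi|-1)! prod_{B in pi} E[prod_{i in B} X_i] *)
Definition cumulant (k : nat) (X : 'I_k -> T -> R) : R :=
  \sum_(Q : {set {set 'I_k}} | finset.partition Q [set: 'I_k]%SET)
     ((-1) ^+ (#|Q|.-1) * (#|Q|.-1)`!%:R *
      \prod_(B in Q) Ex (fun x => \prod_(i in B) X i x)).

Definition autocov (Z : int -> T -> R) (j : int) : R :=
  Ex (fun x => Z 0 x * Z j x) - Ex (Z 0) * Ex (Z j).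

Definition Zvec (Z : int -> T -> R) (r : nat) (js : 'I_r -> int) :
  'I_r.+1 -> T -> R :=
  fun i => Z (oapp js 0 (unlift ord0 i)).

Definition cyl (Z : int -> T -> R) (s : seq (int * set R)) : set T :=
  [set w | forall q, q \in s -> q.2 (Z q.1 w)].

Definition meas_spec (s : seq (int * set R)) : Prop :=
  forall q, q \in s -> measurable q.2.

(* stationarity: all finite-dimensional distributions are shift invariant
   (distributions on cylinder rectangles, which determine them) *)
Definition stationary (Z : int -> T -> R) : Prop :=
  forall (k : int) (s : seq (int * set R)), meas_spec s ->
    P (cyl Z [seq (q.1 + k, q.2) | q <- s]) = P (cyl Z s).

Definition assumptionZ (Z : int -> T -> R) : Prop :=
  (forall j, measurable_fun [set: T] (Z j)) /\
  stationary Z /\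
  (forall k : nat, (0 < k)%N ->
     P.-integrable [set: T] (fun x => ((`|Z 0 x|) ^+ k)%:E)) /\
  ((\int[P]_x (Z 0 x)%:E)%E = 0%E) /\
  (forall r : nat, (0 < r)%N ->
     exists M : R, forall N : nat,
       \sum_(jj : {ffun 'I_r -> 'I_(N.*2.+1)})
          `|cumulant (Zvec Z (fun l => (jj l)%:Z - N%:Z))| <= M).

Definition iid_copies (Z : int -> T -> R) (Zc : nat -> int -> T -> R) : Prop :=
  (forall i j, measurable_fun [set: T] (Zc i j)) /\
  (forall i (s : seq (int * set R)), (0 < i)%N -> meas_spec s ->
     P (cyl (Zc i) s) = P (cyl Z s)) /\
  (forall (m : nat) (idx : 'I_m -> nat) (S : 'I_m -> seq (int * set R)),
     injective idx -> (forall l, 0 < idx l)%N -> (forall l, meas_spec (S l)) ->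
     P [set w | forall l, cyl (Zc (idx l)) (S l) w] =
     (\prod_(l < m) P (cyl (Zc (idx l)) (S l)))%E).

(* spectral density f_Z(theta) = sum_{j in Z} e^{2 pi i j theta} R(j);
   by the symmetry R(-j) = R(j) this is the (real) symmetric-partial-sum limit
   of sum_{|j| <= N} R(j) cos(2 pi j theta) *)
Definition specdens (Z : int -> T -> R) (theta : R) : R :=
  limn (fun N : nat => \sum_(j < N.*2.+1)
          autocov Z ((j : nat)%:Z - N%:Z) *
          cos (2 * pi * ((j : nat)%:Z - N%:Z)%:~R * theta)).

(* int g d nu_Z, with nu_Z = m o f_Z^{-1}, m Lebesgue measure on [0,1] *)
Definition nuZ_int (Z : int -> T -> R) (g : R -> R) : R :=
  fine (\int[lebesgue_measure]_(t in `[0%R, 1%R]) (g (specdens Z t))%:E).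

(* banded sample covariance matrix Y^{(p)} at outcome w:
   Y_{ij} = 1{|i-j| <= b} (X^T X)_{ij},  X_{kj} = Z^{(k)}_j / sqrt n,
   rows k = 1..n, columns (times) j = 1..p *)
Definition Ymat (Zc : nat -> int -> T -> R) (n : nat) (b : R) (p : nat) (w : T)
  : 'M[R]_p :=
  \matrix_(i < p, j < p)
     (if `|(i : nat)%:R - (j : nat)%:R| <= b :> R then
        \sum_(k < n) (Zc k.+1 (i : nat).+1%:Z w / Num.sqrt n%:R) *
                     (Zc k.+1 (j : nat).+1%:Z w / Num.sqrt n%:R)
      else 0).

Definition eigenvalue_list (p : nat) (A : 'M[R]_p) (lam : 'I_p -> R) : Prop :=
  char_poly A = \prod_(i < p) ('X - (lam i)%:P).

End Defs.

(* Main.v *)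
Require Import Defs.
From HB Require Import structures.
From mathcomp Require Import all_boot all_order all_algebra.
From mathcomp Require Import complex.
From mathcomp Require Import all_classical all_reals all_analysis.
From mathcomp Require Import measurable_realfun.
From mathcomp Require Import ring lra zify.
Set Implicit Arguments. Unset Strict Implicit. Unset Printing Implicit Defensive.
Import Order.TTheory GRing.Theory Num.Theory.
Import numFieldNormedType.Exports.
Local Open Scope classical_set_scope.
Local Open Scope ring_scope.

(** The matrix [Y] is close to its mean in Hilbert-Schmidt norm: the entries of
    [Y] have variance [O(1/n)] by independence of the rows, and only [O(p b)] of
    them are nonzero, so [E ||Y - E Y||^2 / p = O(b/n)] tends to [0].  The mean
    is a banded Toeplitz matrix; since the autocovariances are summable and [b]
    tends to infinity, it is in turn close, in the same normalised norm, to the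
    circulant matrix with entries [R(i - j)] on a fixed large band [m].  That
    circulant has the explicit eigenvalues [S_m(k/p)], [S_m] being the partial
    Fourier sum of the spectral density, so its empirical measure is a Riemann
    sum for the law of [S_m], and [S_m] converges to [f_Z] pointwise.

    Closeness in Hilbert-Schmidt norm controls spectral measures: if [U], [V]
    diagonalise [A], [B], then [w = |U V^*|^2] is doubly stochastic and
    [\sum w i j (l i - m j)^2 = ||A - B||^2], so that
    [|f x - f y| <= e + K (x - y)^2] for [x] in [R] and [y] in a compact set
    gives [|\sum f (l i) - \sum f (m j)| <= p e + K ||A - B||^2]. *)

(** * Unitarily diagonalisable matrices *)

Section Frobenius.
Variable C : numClosedFieldType.
Local Open Scope sesquilinear_scope.

Lemma mxtrace_sqnorm m n (A : 'M[C]_(m, n)) :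
  \tr (A *m A^t*) = \sum_i \sum_j `|A i j| ^+ 2.
Proof.
apply: eq_bigr => i _; rewrite mxE; apply: eq_bigr => j _.
by rewrite !mxE normCK.
Qed.

(** The squared Hilbert-Schmidt norm is the trace of [A *m A^t*], so cyclicity of the trace cancels
    the unitary factors. *)
Lemma sqnorm_unitary n (U V A : 'M[C]_n) :
  U \is unitarymx -> V \is unitarymx ->
  \sum_i \sum_j `|(U *m A *m V^t*) i j| ^+ 2 = \sum_i \sum_j `|A i j| ^+ 2.
Proof.
move=> Uu Vu; rewrite -!mxtrace_sqnorm !trmx_mul !map_mxM trmxCK.
rewrite !mulmxA (mulmxKtV _ Vu)// mxtrace_mulC !mulmxA -(invmx_unitary Uu).
by rewrite mulVmx ?mul1mx ?unitarymx_unit.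
Qed.

Lemma unitary_row_sum n (U : 'M[C]_n) i :
  U \is unitarymx -> \sum_j `|U i j| ^+ 2 = 1.
Proof.
move=> /unitarymxP/matrixP/(_ i i); rewrite !mxE eqxx mulr1n => <-.
by apply: eq_bigr => j _; rewrite !mxE normCK.
Qed.

Lemma unitary_col_sum n (U : 'M[C]_n) j :
  U \is unitarymx -> \sum_i `|U i j| ^+ 2 = 1.
Proof.
rewrite -trmx_unitary => /(unitary_row_sum j) <-.
by apply: eq_bigr => i _; rewrite mxE.
Qed.

(** Multiplying the difference by [U] on the left and [V^t*] on the right keeps its norm and gives
    [D_l W - W D_m] with [W = U *m V^t*], whose entry at [i, j] is [(l i - m j) W i j]. *)
Lemma spectral_coupling n (U V : 'M[C]_n) (l m : 'rV[C]_n) :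
  U \is unitarymx -> V \is unitarymx ->
  \sum_i \sum_j `|(U *m V^t*) i j| ^+ 2 * `|l 0 i - m 0 j| ^+ 2 =
  \sum_i \sum_j `|(U^t* *m diag_mx l *m U - V^t* *m diag_mx m *m V) i j| ^+ 2.
Proof.
move=> Uu Vu; rewrite -(sqnorm_unitary _ Uu Vu).
have -> : U *m (U^t* *m diag_mx l *m U - V^t* *m diag_mx m *m V) *m V^t* =
   diag_mx l *m (U *m V^t*) - (U *m V^t*) *m diag_mx m.
  rewrite mulmxBr mulmxBl !mulmxA (unitarymxP Uu) mul1mx; congr (_ - _).
  by rewrite -!mulmxA (unitarymxP Vu) mulmx1.
apply: eq_bigr => i _; apply: eq_bigr => j _.
rewrite -exprMn -normrM mul_diag_mx mul_mx_diag !mxE.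
by rewrite mulrBr [l 0 i * _]mulrC.
Qed.

End Frobenius.

Section RealDiag.
Variable R : rcfType.
Local Open Scope sesquilinear_scope.
Local Notation toC := (real_complex R).

(** The unitary is complex because circulants are diagonalised by the Fourier matrix; the values
    [mu] stay real and follow the order of the rows of [U]. *)
Definition unitarily_diag n (A : 'M[R]_n) (mu : 'I_n -> R) : Prop :=
  exists2 U : 'M[R[i]]_n, U \is unitarymx &
    map_mx toC A = U^t* *m diag_mx (\row_i toC (mu i)) *m U.

(** This is the spectral theorem over [R[i]]. The listing [lam] comes in an arbitrary order, so it
    matches the diagonal only up to a permutation. *)
Lemma eigenvalues_unitarily_diag n (A : 'M[R]_n) (lam : 'I_n -> R) :
  (forall i j, A i j = A j i) ->
  char_poly A = \prod_(i < n) ('X - (lam i)%:P) ->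
  exists2 mu, unitarily_diag A mu & perm_eq (codom lam) (codom mu).
Proof.
move=> Asym Alam.
set Ac := map_mx toC A.
have Ah : Ac \is hermsymmx.
  apply: realsym_hermsym.
    apply/is_hermitianmxP; rewrite expr0 scale1r map_mx_id//.
    by apply/matrixP => i j; rewrite !mxE Asym.
  by apply/mxOverP => i j; rewrite mxE complex_real.
have /orthomx_spectralP := hermitian_normalmx Ah.
have /mxOverP sr := hermitian_spectral_diag_real Ah.
have Uu := spectral_unitarymx Ac.
set U := spectralmx Ac in Uu *; set sp := spectral_diag Ac in sr *.
move=> AE.
pose mu i := complex.Re (sp 0 i).
have spE : sp = \row_i toC (mu i).
  by apply/rowP => i; rewrite mxE /mu RRe_real.
exists mu; first by exists U => //; rewrite -invmx_unitary// -spE.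
have cp : char_poly Ac = \prod_(i < n) ('X - (toC (mu i))%:P).
  have Uunit : U \in unitmx by exact: unitarymx_unit.
  have -> : char_poly Ac = char_poly (diag_mx sp).
    rewrite AE /char_poly /char_poly_mx.
    pose P := map_mx polyC U; pose Q := map_mx polyC (invmx U).
    have PQ : Q *m P = 1%:M by rewrite -map_mxM mulVmx// map_mx1.
    (* Since ['X%:M] is central, the whole characteristic matrix is conjugated. *)
    have -> : 'X%:M - map_mx polyC (invmx U *m diag_mx sp *m U) =
       Q *m ('X%:M - map_mx polyC (diag_mx sp)) *m P.
      rewrite mulmxBr mulmxBl !map_mxM; congr (_ - _).
      by rewrite scalar_mxC -mulmxA PQ mulmx1.
    by rewrite !det_mulmx mulrAC -det_mulmx PQ det1 mul1r.
  rewrite char_poly_trig; last by apply: diag_mx_is_trig.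
  by apply: eq_bigr => i _; rewrite spE !mxE eqxx mulr1n.
have cp2 : char_poly Ac = \prod_(i < n) ('X - (toC (lam i))%:P).
  rewrite -(map_char_poly toC) Alam rmorph_prod; apply: eq_bigr => i _.
  by rewrite rmorphB /= map_polyX map_polyC.
(* Unique factorisation into linear factors over [R[i]]; injectivity of the embedding then brings
   the permutation back to [R]. *)
have : perm_eq (map toC (codom lam)) (map toC (codom mu)).
  apply: prod_XsubC_eq; rewrite !(big_map, big_image) /=.
  by rewrite -cp -cp2.
by move/perm_map_inj; apply; apply: complexI.
Qed.

Lemma sum_perm_codom n (l m : 'I_n -> R) (f : R -> R) :
  perm_eq (codom l) (codom m) -> \sum_i f (l i) = \sum_i f (m i).
Proof.
move=> lm; have : \sum_(x <- codom l) f x = \sum_(x <- codom m) f x.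
  exact: perm_big.
by rewrite !big_image.
Qed.

Lemma unitarily_diag_coupling n (A B : 'M[R]_n) (l m : 'I_n -> R) :
  unitarily_diag A l -> unitarily_diag B m ->
  exists w : 'I_n -> 'I_n -> R, [/\ forall i j, 0 <= w i j,
    forall i, \sum_j w i j = 1, forall j, \sum_i w i j = 1 &
    \sum_i \sum_j w i j * (l i - m j) ^+ 2 =
    \sum_i \sum_j (A i j - B i j) ^+ 2].
Proof.
move=> [U Uu AE] [V Vu BE].
have Vu' : V^t* \is unitarymx by rewrite trmxC_unitary.
have Wu : U *m V^t* \is unitarymx := mul_unitarymx Uu Vu'.
set W := U *m V^t* in Wu *.
(* This is [|W i j|^2], expressed so that the weights live in [R]. *)
pose w i j := complex.Re (W i j) ^+ 2 + complex.Im (W i j) ^+ 2.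
have wE i j : toC (w i j) = `|W i j| ^+ 2 by rewrite -add_Re2_Im2.
exists w; split.
- by move=> i j; rewrite addr_ge0// sqr_ge0.
- move=> i; apply: (@complexI R); rewrite rmorph_sum rmorph1.
  by rewrite -(unitary_row_sum i Wu); apply: eq_bigr => j _; rewrite -wE.
- move=> i; apply: (@complexI R); rewrite rmorph_sum rmorph1.
  by rewrite -(unitary_col_sum i Wu); apply: eq_bigr => j _; rewrite -wE.
have realK (x : R) : toC (x ^+ 2) = `|toC x| ^+ 2.
  by rewrite real_normK ?complex_real// rmorphXn.
apply: (@complexI R); rewrite !rmorph_sum.
transitivity (\sum_i \sum_j `|W i j| ^+ 2 *
   `|(\row_i toC (l i)) 0 i - (\row_i toC (m i)) 0 j| ^+ 2).
  apply: eq_bigr => i _; rewrite rmorph_sum; apply: eq_bigr => j _.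
  by rewrite rmorphM/= wE realK rmorphB !mxE.
rewrite (spectral_coupling _ _ Uu Vu) -AE -BE.
apply: eq_bigr => i _; rewrite rmorph_sum; apply: eq_bigr => j _.
by rewrite /= realK rmorphB !mxE.
Qed.

Lemma unitarily_diag_compare n (A B : 'M[R]_n) (l m : 'I_n -> R)
    (f : R -> R) (e K : R) :
  unitarily_diag A l -> unitarily_diag B m ->
  (forall i j, `|f (l i) - f (m j)| <= e + K * (l i - m j) ^+ 2) ->
  `|\sum_i f (l i) - \sum_i f (m i)| <=
    n%:R * e + K * \sum_i \sum_j (A i j - B i j) ^+ 2.
Proof.
move=> dA dB fK; have [w [w0 w1 w2 wE]] := unitarily_diag_coupling dA dB.
(* Unit row sums and unit column sums turn the two single sums into double sums with common
   weights. *)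
have -> : \sum_i f (l i) - \sum_i f (m i) =
    \sum_i \sum_j w i j * (f (l i) - f (m j)).
  transitivity (\sum_i \sum_j w i j * f (l i) - \sum_i \sum_j w i j * f (m j)).
    congr (_ - _); first by apply: eq_bigr => i _; rewrite -mulr_suml w1 mul1r.
    by rewrite exchange_big; apply: eq_bigr => i _; rewrite -mulr_suml w2 mul1r.
  rewrite -sumrB; apply: eq_bigr => i _; rewrite -sumrB.
  by apply: eq_bigr => j _; rewrite mulrBr.
apply: le_trans (ler_norm_sum _ _ _) _.
apply: le_trans (_ : \sum_i \sum_j w i j * (e + K * (l i - m j) ^+ 2) <= _).
  apply: ler_sum => i _; apply: le_trans (ler_norm_sum _ _ _) _.
  by apply: ler_sum => j _; rewrite normrM ger0_norm// ler_wpM2l.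
rewrite -wE mulr_sumr.
have -> : n%:R * e = \sum_(i < n) e.
  by rewrite sumr_const card_ord mulr_natl.
rewrite -big_split /=; apply: ler_sum => i _.
have -> : e = \sum_j w i j * e by rewrite -mulr_suml w1 mul1r.
rewrite mulr_sumr -big_split /=; apply: ler_sum => j _.
by rewrite -mulr_suml w1 mul1r mulrDr mulrCA.
Qed.

End RealDiag.

(** * Circulant matrices *)

Section DFT.
Variable R : realType.
Local Open Scope sesquilinear_scope.
Local Notation toC := (real_complex R).

Definition cis (x : R) : R[i] := Complex (cos x) (sin x).

Lemma cisD x y : cis (x + y) = cis x * cis y.
Proof.
rewrite /cis cosD sinD; simpc; congr Complex.
by rewrite addrC mulrC [X in X + _]mulrC.
Qed.

Lemma cisX x k : cis x ^+ k = cis (x *+ k).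
Proof.
elim: k => [|k IH]; first by rewrite expr0 mulr0n /cis cos0 sin0.
by rewrite exprS IH mulrS cisD.
Qed.

Lemma cis_neq0 x : cis x != 0.
Proof.
apply/eqP => -[c0 s0]; have := cos2Dsin2 x.
by rewrite c0 s0 expr0n addr0 => /eqP; rewrite eq_sym oner_eq0.
Qed.

Lemma cisV x : (cis x)^-1 = cis (- x).
Proof.
apply: (mulfI (cis_neq0 x)); rewrite mulfV ?cis_neq0// -cisD subrr.
by rewrite /cis cos0 sin0.
Qed.

Lemma conj_cis x : (cis x)^* = (cis x)^-1.
Proof. by rewrite cisV /cis cosN sinN. Qed.

Lemma cisDV x : cis x + (cis x)^-1 = toC (2 * cos x).
Proof.
rewrite cisV /cis cosN sinN; simpc.
by rewrite mulr_natl mulr2n.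
Qed.

(** If [cos x = 1], the double-angle formula gives [cos (x / 2) ^+ 2 = 1], whereas [sin (x / 2) > 0]
    because [x / 2] lies strictly between [0] and [pi]. *)
Lemma cis_eq1 x : 0 < x < 2 * pi -> cis x != 1.
Proof.
move=> /andP[x0 x2]; apply/eqP => -[c1 _].
have : 0 < sin (x / 2) by apply: sin_gt0_pi; rewrite divr_gt0// ltr_pdivrMr// mulrC.
have : cos x = cos (x / 2) ^+ 2 *+ 2 - 1.
  by rewrite -cos_mulr2n (_ : x / 2 *+ 2 = x)// -mulr_natr divfK.
rewrite c1 => c2 s0; have := cos2Dsin2 (x / 2); have := exprn_gt0 2 s0.
lra.
Qed.

Section circulant.
Variable p : nat.
Hypothesis p0 : (0 < p)%N.

Let w : R[i] := cis (2 * pi / p%:R).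

Let wX k : w ^+ k = cis (2 * pi / p%:R * k%:R).
Proof. by rewrite cisX mulr_natr. Qed.

Let prim_w : p.-primitive_root w.
Proof.
have p0R : 0 < p%:R :> R by rewrite ltr0n.
apply/andP; split => //; apply/forallP => i; apply/eqP.
rewrite unity_rootE wX.
have [ip|ip] := eqVneq i.+1 p.
  by rewrite ip divfK ?(gt_eqF p0R)// /cis mulr_natl cos2pi sin2pi !eqxx.
apply/negbTE/cis_eq1; rewrite !(mulr_gt0, divr_gt0) ?pi_gt0 ?invr_gt0//=.
rewrite -mulrA -[ltRHS]mulr1 ltr_pM2l ?mulr_gt0 ?pi_gt0//.
by rewrite mulrC ltr_pdivrMr// mul1r ltr_nat ltn_neqAle ip ltn_ord.
Qed.

Let w0 k : w ^+ k != 0.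
Proof. by rewrite expf_neq0// cis_neq0. Qed.

(** The ratio [z] is a [p]-th root of unity; when [z != 1], the factorisation of [z ^+ p - 1] makes
    the geometric sum vanish. *)
Lemma root_unity_sum (a b : nat) :
  \sum_(k < p) (w ^+ a / w ^+ b) ^+ k = (p%:R * (a == b %[mod p])%:R) :> R[i].
Proof.
rewrite -(eq_prim_root_expr prim_w).
set z := _ / _; have -> : (w ^+ a == w ^+ b) = (z == 1).
  by rewrite -[RHS](inj_eq (mulIf (w0 b))) /z divfK// mul1r.
have [->|z1] := eqVneq z 1.
  by under eq_bigr do rewrite expr1n; rewrite sumr_const card_ord mulr1.
rewrite mulr0; have := subrX1 z p.
have -> : z ^+ p = 1.
  rewrite /z exprMn exprVn -!exprM !(mulnC _ p) !exprM.
  by rewrite (prim_expr_order prim_w) !expr1n divr1.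
by rewrite subrr => /esym/eqP; rewrite mulf_eq0 subr_eq0 (negbTE z1) => /eqP.
Qed.

(** The normalised discrete Fourier matrix. *)
Let U : 'M[R[i]]_p := \matrix_(k, j) ((w ^+ j) ^+ k / toC (Num.sqrt p%:R)).

Let conjU k j : (U k j)^* = ((w ^+ j) ^- k / toC (Num.sqrt p%:R)).
Proof.
rewrite !mxE rmorphM/= fmorphV/= !rmorphXn/=.
have -> : w^* = w^-1 by exact: conj_cis.
rewrite (CrealP _) ?complex_real//.
by rewrite !exprVn.
Qed.

Let sqrtp2 : toC (Num.sqrt p%:R) * toC (Num.sqrt p%:R) = p%:R.
Proof. by rewrite -rmorphM -expr2 sqr_sqrtr ?ler0n// rmorph_nat. Qed.

Let pC0 : (p%:R : R[i]) != 0.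
Proof. by rewrite pnatr_eq0 -lt0n. Qed.

Let U_unitary : U \is unitarymx.
Proof.
rewrite -trmx_unitary; apply/unitarymxP/matrixP => i j; rewrite !mxE.
transitivity (\sum_(k < p) (w ^+ i / w ^+ j) ^+ k / p%:R).
  apply: eq_bigr => k _; rewrite [X in X * _]mxE.
  have -> : (U^T^t*) k j = (U k j)^* by rewrite !mxE.
  rewrite conjU mxE.
  by rewrite mulrACA -invfM sqrtp2 expr_div_n.
rewrite -mulr_suml root_unity_sum !modn_small// mulrAC divff// mul1r.
by rewrite -val_eqE.
Qed.

(** The symmetric Fourier partial sum over lags [-m] to [m] of the even extension of [r], with
    opposite lags merged into cosines. *)
Definition trig_poly (m : nat) (r : nat -> R) (t : R) : R :=
  r 0 + \sum_(l < m) r l.+1 * (2 * cos (2 * pi * l.+1%:R * t)).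

(** Congruences, with contributions that add up when bands overlap, make the diagonalisation valid
    for every [m]; only the entry formula needs [2 * m < p]. *)
Definition circulant (m : nat) (r : nat -> R) : 'M[R]_p :=
  \matrix_(i, j) (r 0 * (i == j)%:R + \sum_(l < m) r l.+1 *
    ((j + l.+1 == i %[mod p])%:R + (j == i + l.+1 %[mod p])%:R)).

(** An entry of the conjugated diagonal matrix is a Fourier sum of the eigenvalues; expanding
    [trig_poly], each frequency gives a sum that [root_unity_sum] turns into a congruence
    indicator. *)
Lemma circulant_unitarily_diag m r :
  unitarily_diag (circulant m r) (fun k : 'I_p => trig_poly m r (k%:R / p%:R)).
Proof.
exists U => //; apply/matrixP => i j.
rewrite mul_mx_diag !mxE.
have E k : toC (trig_poly m r (k%:R / p%:R)) =
   toC (r 0) + \sum_(l < m) toC (r l.+1) * ((w ^+ l.+1) ^+ k + (w ^+ l.+1) ^- k).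
  rewrite rmorphD rmorph_sum; congr (_ + _); apply: eq_bigr => l _.
  rewrite rmorphM; congr (_ * _); rewrite -exprM wX natrM.
  by rewrite cisDV; congr (toC (_ * cos _)); ring.
have -> : \sum_(j0 < p) (\matrix_(i0, j1) (U^t* i0 j1 *
    (\row_i1 toC (trig_poly m r (i1%:R / p%:R))) 0 j1)) i j0 * U j0 j =
  \sum_(k < p) (p%:R^-1 * (w ^+ j / w ^+ i) ^+ k) * toC (trig_poly m r (k%:R / p%:R)).
  apply: eq_bigr => k _; rewrite !mxE -/(U k i).
  have := conjU k i; rewrite [in X in X -> _]mxE => ->.
  rewrite mulrAC; congr (_ * _); rewrite mulrACA -invfM sqrtp2 mulrC expr_div_n.
  by congr (_ * _); rewrite mulrC.
transitivity (toC (r 0) * (p%:R^-1 * \sum_(k < p) (w ^+ j / w ^+ i) ^+ k) +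
  \sum_(l < m) toC (r l.+1) * (p%:R^-1 * \sum_(k < p) (w ^+ (j + l.+1) / w ^+ i) ^+ k +
     p%:R^-1 * \sum_(k < p) (w ^+ j / w ^+ (i + l.+1)) ^+ k)).
  rewrite !root_unity_sum mulKf// !modn_small//.
  rewrite rmorphD rmorphM rmorph_nat rmorph_sum/= -val_eqE eq_sym.
  congr (_ + _); apply: eq_bigr => l _.
  rewrite !root_unity_sum !mulKf// rmorphM rmorphD !rmorph_nat.
  by rewrite [in RHS](modn_small (ltn_ord i)) [in RHS](modn_small (ltn_ord j)).
under [RHS]eq_bigr do rewrite E mulrDr.
rewrite big_split/=; congr (_ + _).
  by rewrite !mulr_sumr; apply: eq_bigr => k _; rewrite mulrC.
under [RHS]eq_bigr do rewrite mulr_sumr.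
rewrite exchange_big; apply: eq_bigr => l _ /=.
rewrite !mulr_sumr -big_split/= mulr_sumr; apply: eq_bigr => k _.
rewrite mulrCA; congr (_ * _); rewrite !mulrDr -!mulrA; congr (_ * _ + _ * _).
  by rewrite exprD !expr_div_n exprMn mulrAC.
by rewrite exprD !expr_div_n exprMn invfM mulrA.
Qed.

End circulant.
End DFT.

(** * Banded Toeplitz matrices *)

Section toeplitz.
Variable R : realType.
Implicit Types (r g : nat -> R) (m p : nat).

(** This is [|i - j|] in [nat]: at least one of the truncated subtractions vanishes. *)
Definition gap (i j : nat) : nat := (i - j + (j - i))%N.

Lemma normB_gap (i j : nat) : `|i%:R - j%:R| = (gap i j)%:R :> R.
Proof.
rewrite /gap; have [ij|/ltnW ij] := leqP i j.
  by rewrite distrC -natrB// ger0_norm//; congr (_%:R); lia.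
by rewrite -natrB// ger0_norm//; congr (_%:R); lia.
Qed.

Lemma sum_indicator p (x : nat) (c : R) :
  \sum_(i < p) c * (x == i)%:R = if (x < p)%N then c else 0.
Proof.
case: ifPn => xp.
  rewrite (bigD1 (Ordinal xp))//= eqxx mulr1 big1 ?addr0// => i.
  by rewrite -val_eqE/= eq_sym => /negbTE ->; rewrite mulr0.
rewrite big1// => i _; case: eqP => [E|]; last by rewrite mulr0.
by move: xp; rewrite E ltn_ord.
Qed.

Lemma sum_indicator_le p (x : nat) (c : R) : 0 <= c ->
  \sum_(i < p) c * (x == i)%:R <= c.
Proof. by rewrite sum_indicator; case: ifP. Qed.

Lemma sum_lt_le p m : \sum_(i < p) (i < m)%:R <= m%:R :> R.
Proof.
apply: (@le_trans _ _ (\sum_(i < p) \sum_(l < m) 1 * (l == i :> nat)%:R)).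
  apply: ler_sum => i _.
  under eq_bigr do rewrite eq_sym.
  by rewrite sum_indicator; case: ifP.
rewrite exchange_big/=; apply: le_trans (ler_sum _ _) _.
  by move=> l _; exact: sum_indicator_le.
by rewrite sumr_const card_ord.
Qed.

Lemma sum_ge_le p m : \sum_(i < p) (p - m <= i)%:R <= m%:R :> R.
Proof.
rewrite (reindex_inj rev_ord_inj)/=; apply: le_trans (sum_lt_le p m).
by apply: ler_sum => i _; rewrite ler_nat; have := ltn_ord i; lia.
Qed.

(** A given distance [d] from [i] is attained by at most two indices, [i + d] and [i - d]. *)
Lemma sum_gap_le p g (i : 'I_p) : (forall d, 0 <= g d) ->
  \sum_(j < p) g (gap i j) <= 2 * \sum_(d < p) g d.
Proof.
move=> g0.
apply: (@le_trans _ _ (\sum_(j < p) \sum_(d < p)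
   (g d * (i + d == j)%N%:R + g d * (i == j + d :> nat)%N%:R))).
  apply: ler_sum => j _.
  have gp : (gap i j < p)%N by have := ltn_ord i; have := ltn_ord j; rewrite /gap; lia.
  rewrite (bigD1 (Ordinal gp))//= -[leLHS]addr0 lerD//.
    rewrite -mulrDr ler_peMr// -natrD ler1n.
    have : ((i + gap i j == j) || (i == j + gap i j :> nat))%N by rewrite /gap; lia.
    by case/orP => ->; lia.
  by apply: sumr_ge0 => d _; rewrite addr_ge0// mulr_ge0.
rewrite exchange_big/= mulr_sumr; apply: ler_sum => d _.
rewrite big_split/= mulr_natl mulr2n lerD ?sum_indicator_le//.
(* With truncated subtraction [i = j + d] still implies [i - d = j], so the indicator can only
   grow. *)
apply: (@le_trans _ _ (\sum_(j < p) g d * (i - d == j)%N%:R)); last first.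
  exact: sum_indicator_le.
apply: ler_sum => j _; rewrite ler_wpM2l// ler_nat; lia.
Qed.

Lemma eqmod_lt p x a : (a < p)%N -> (x < 2 * p)%N ->
  (x == a %[mod p]) = (x == a) || (x == a + p)%N.
Proof.
move=> ap x2; rewrite (modn_small ap).
have [xp|px] := ltnP x p.
  by rewrite modn_small//; lia.
rewrite -[in LHS](subnK px) modnDr modn_small; lia.
Qed.

(** The band splits into a part near the diagonal and a wrapped part in the two corners; [2 * m < p]
    keeps them disjoint. *)
Lemma circulantE p m r (i j : 'I_p) : (2 * m < p)%N ->
  circulant p m r i j = (if (gap i j <= m)%N then r (gap i j) else 0) +
    (if (p - gap i j <= m)%N then r (p - gap i j)%N else 0).
Proof.
move=> mp; rewrite mxE.
have gp : (gap i j < p)%N by have := ltn_ord i; have := ltn_ord j; rewrite /gap; lia.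
have -> : (i == j) = (gap i j == 0)%N by rewrite -val_eqE /gap/=; lia.
have E (x : nat) : (0 < x)%N ->
    \sum_(l < m) r l.+1 * (l.+1 == x)%:R = if (x <= m)%N then r x else 0.
  case: x => // x _; rewrite -sum_indicator; apply: eq_bigr => l _.
  by rewrite eqSS eq_sym; case: eqP => [->//|]; rewrite !mulr0.
have -> : \sum_(l < m) r l.+1 * ((j + l.+1 == i %[mod p])%:R + (j == i + l.+1 %[mod p])%:R) =
  \sum_(l < m) r l.+1 * (l.+1 == gap i j)%:R +
  \sum_(l < m) r l.+1 * (l.+1 == p - gap i j)%N%:R.
  rewrite -big_split/=; apply: eq_bigr => l _; rewrite -mulrDr; congr (_ * _).
  have := ltn_ord i; have := ltn_ord j; have := ltn_ord l => lm jp ip.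
  rewrite [(j == _ %[mod p])]eq_sym !eqmod_lt; [|lia..].
  rewrite -!natrD; congr (_%:R); rewrite /gap; lia.
rewrite [X in _ + (_ + X)]E ?subn_gt0// addrA; congr (_ + _).
have [->|g0] := eqVneq (gap i j) 0%N.
  by rewrite mulr1 big1 ?addr0// => l _; rewrite mulr0.
by rewrite mulr0 add0r E// lt0n.
Qed.

(** Within distance [m] the matrices agree, as [m <= b]. Farther out, the Toeplitz entries give the
    tail of squares, each distance occurring at most twice per row. Wrapped circulant entries, of
    size at most [c], lie in two corner blocks of side [m]. A further factor 2 comes from
    [(x - y)^2 <= 2 x^2 + 2 y^2]. *)
Lemma toeplitz_circulant_dist p m r (b c : R) :
  (2 * m < p)%N -> m%:R <= b -> (forall d, `|r d| <= c) ->
  \sum_(i < p) \sum_(j < p)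
    ((if `|i%:R - j%:R| <= b then r (gap i j) else 0) - circulant p m r i j) ^+ 2
  <= 4 * p%:R * (\sum_(d < p) (m < d)%N%:R * r d ^+ 2) + 4 * c ^+ 2 * m%:R ^+ 2.
Proof.
move=> mp mb rc.
have c2 d : r d ^+ 2 <= c ^+ 2.
  by rewrite -real_normK ?num_real// ler_sqr ?nnegrE// (le_trans _ (rc d)).
apply: (@le_trans _ _ (\sum_(i < p) \sum_(j < p)
   (2 * ((m < gap i j)%N%:R * r (gap i j) ^+ 2) +
    2 * c ^+ 2 * ((i < m)%N%:R * (p - m <= j)%N%:R + (j < m)%N%:R * (p - m <= i)%N%:R)))).
  apply: ler_sum => i _; apply: ler_sum => j _; rewrite circulantE//.
  have gp : (gap i j < p)%N by have := ltn_ord i; have := ltn_ord j; rewrite /gap; lia.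
  have [gm|mg] := leqP (gap i j) m.
    have -> : `|i%:R - j%:R| <= b.
      by rewrite normB_gap (le_trans _ mb)// ler_nat.
    have -> : (p - gap i j <= m)%N = false by lia.
    rewrite addr0 subrr expr0n/= mul0r mulr0 add0r.
    rewrite mulr_ge0 ?addr_ge0 ?mulr_ge0 ?sqr_ge0 ?ler0n//;
      exact: le_trans (normr_ge0 _) (rc 0%N).
  rewrite add0r mul1r.
  apply: le_trans (_ : 2 * r (gap i j) ^+ 2 + 2 * (c ^+ 2 * (p - gap i j <= m)%N%:R) <= _).
    set x := if _ then _ else _; set y := if _ then _ else _.
    have hx : x ^+ 2 <= r (gap i j) ^+ 2.
      by rewrite /x; case: ifP => // _; rewrite expr0n sqr_ge0.
    have hy : y ^+ 2 <= c ^+ 2 * (p - gap i j <= m)%N%:R.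
      by rewrite /y; case: ifP => _; rewrite ?mulr1 ?mulr0 ?expr0n.
    have := sqr_ge0 (x + y).
    nra.
  rewrite lerD2l -mulrA ler_wpM2l// ler_wpM2l ?sqr_ge0//.
  rewrite -!natrM -natrD ler_nat.
  move: gp mg; rewrite /gap; have := ltn_ord i; have := ltn_ord j.
  case: (leqP (p - (i - j + (j - i))) m) => // h1 h2 h3 h4 h5.
  have [ij|ij] := leqP i j.
    have -> : (i < m)%N by lia.
    by have -> : (p - m <= j)%N by lia.
  have -> : (j < m)%N by lia.
  have -> : (p - m <= i)%N by lia.
  by rewrite addnC.
under eq_bigr do rewrite big_split/= -!mulr_sumr big_split/= -mulr_sumr -mulr_suml.
rewrite big_split/= -!mulr_sumr big_split/= -!mulr_suml -mulr_sumr.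
have S := sum_lt_le p m; have S' := sum_ge_le p m.
apply: lerD.
  rewrite -(ler_pM2l (_ : 0 < 2^-1 :> R)) ?invr_gt0// mulKf//.
  apply: le_trans (ler_sum _ _) _.
    move=> i _; apply: (@sum_gap_le p (fun d => (m < d)%N%:R * r d ^+ 2)) => d.
    by rewrite mulr_ge0 ?sqr_ge0.
  rewrite sumr_const card_ord -mulr_natl; lra.
have P : (\sum_(i < p) (i < m)%N%:R) * (\sum_(i < p) (p - m <= i)%N%:R) <= m%:R ^+ 2 :> R.
  by rewrite expr2 ler_pM// sumr_ge0.
rewrite [X in _ + X]mulrC.
have := ler_wpM2l (sqr_ge0 c) P; lra.
Qed.

End toeplitz.

(** * Riemann sums and trigonometric sums *)

Section quad.
Variable R : realType.

(** Continuity handles [x] close to [y]; for distant [x] the bound [2 M] is absorbed by the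
    quadratic term. Compactness makes [K] uniform in [y], while [x] stays unrestricted, as
    eigenvalues of the random matrix have no deterministic bound. *)
Lemma quadratic_modulus (f : R -> R) (M C e : R) :
  continuous f -> (forall x, `|f x| <= M) -> 0 < e ->
  exists2 K, 0 <= K & forall x y, `|y| <= C -> `|f x - f y| <= e + K * (x - y) ^+ 2.
Proof.
move=> fc fM e0.
have M0 : 0 <= M by apply: le_trans (fM 0).
have : near_covering (`[- C, C] : set R) by apply/compact_near_coveringP/segment_compact.
move=> /(_ R (+oo) (fun K y => forall x, `|f x - f y| <= e + K * (x - y) ^+ 2) _).
case.
  move=> y0 _.
  have /cvgrPdist_lt/(_ (e / 2) ltac:(lra))/nbhs_ballP[dl /= dl0 fdl] := fc y0.
  (* Half the radius: [y] within [dl / 2] of [y0] and [x] within [dl / 2] of [y] keep [x] within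
     [dl] of [y0]. *)
  exists (ball y0 (dl / 2), [set K : R | 2 * M / (dl / 2) ^+ 2 <= K]) => /=.
    split; first by apply/nbhs_ballP; exists (dl / 2) => //=; lra.
    by apply: nbhs_pinfty_ge; rewrite num_real.
  move=> [y K] [/= y0y MK] x.
  have K0 : 0 <= K by apply: le_trans MK; rewrite divr_ge0 ?sqr_ge0//; lra.
  rewrite -ball_normE/= in y0y.
  have [xy|xy] := ltP `|x - y| (dl / 2).
    have h1 := fdl y; have h2 := fdl x; rewrite -!ball_normE/= in h1 h2.
    have {}h1 := h1 ltac:(lra).
    have {}h2 := h2 ltac:(by have := ler_distD y y0 x; rewrite [`|y - x|]distrC; lra).
    have := ler_distD (f y0) (f x) (f y); rewrite [`|f x - f y0|]distrC.
    have : 0 <= K * (x - y) ^+ 2 by rewrite mulr_ge0// sqr_ge0.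
    lra.
  have := ler_normB (f x) (f y); have := fM x; have := fM y.
  have : 2 * M <= K * (x - y) ^+ 2.
    rewrite ler_pdivrMr in MK; last by rewrite exprn_gt0//; lra.
    apply: le_trans MK _; rewrite ler_wpM2l// -[leRHS]real_normK ?num_real//.
    by rewrite ler_sqr// nnegrE; lra.
  lra.
move=> K [_ KP].
(* Every number above [K] works; this one is also nonnegative. *)
exists (`|K| + 1) => [|x y yC]; first by rewrite addr_ge0.
apply: KP; first by rewrite (le_lt_trans (ler_norm _))// ltrDl.
by rewrite /= in_itv/=; rewrite ler_norml in yC.
Qed.

Lemma MVT_integral (g : R -> R) (a b : R) : continuous g -> a < b ->
  exists2 c, a < c < b & \int[lebesgue_measure]_(t in `[a, b]) g t = g c * (b - a).
Proof.
move=> gc ab.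
(* Starting at [a - 1] makes the primitive differentiable at [a] as well. *)
pose F x := \int[lebesgue_measure]_(t in `[a - 1, x]) g t.
have gi u v : lebesgue_measure.-integrable `[u, v] (EFin \o g).
  apply: continuous_compact_integrable; first exact: segment_compact.
  exact: continuous_subspaceT.
have dF x : a - 1 < x -> derivable F x 1 /\ F^`()%classic x = g x.
  by move=> ax; apply: (@continuous_FTC1_closed R g (a - 1) x (x + 1)) => //; [lra|exact: gc].
have [||c cab E] := @MVT R F g a b ab.
- move=> x; rewrite in_itv/= => /andP[ax _].
  have [h1 h2] := dF x ltac:(lra).
  by apply: DeriveDef; [exact: h1|rewrite -derive1E; exact: h2].
- apply: derivable_within_continuous => x; rewrite in_itv/= => /andP[ax _].
  by have [] := dF x ltac:(lra).
exists c; first by rewrite in_itv/= in cab.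
rewrite -E /F (@Rintegral_itvB R g (BLeft (a - 1)) (BRight b) a)//.
- rewrite Rintegral_itv_obnd_cbnd//; apply: integrableS (gi a b) => //.
  exact: subset_itv_oc_cc.
- by rewrite bnd_simp; lra.
- by rewrite bnd_simp ltW.
Qed.

Lemma Rintegral_split (g : R -> R) (p : nat) : continuous g -> (0 < p)%N ->
  \int[lebesgue_measure]_(t in `[0, 1]) g t =
  \sum_(k < p) \int[lebesgue_measure]_(t in `[k%:R / p%:R, k.+1%:R / p%:R]) g t.
Proof.
move=> gc p0.
have gi u v : lebesgue_measure.-integrable `[u, v] (EFin \o g).
  apply: continuous_compact_integrable; first exact: segment_compact.
  exact: continuous_subspaceT.
have p0R : 0 < p%:R :> R by rewrite ltr0n.
suff H k : \int[lebesgue_measure]_(t in `[0, k%:R / p%:R]) g t =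
   \sum_(k < k) \int[lebesgue_measure]_(t in `[k%:R / p%:R, k.+1%:R / p%:R]) g t.
  by rewrite -H divff// gt_eqF.
elim: k => [|k IH]; first by rewrite big_ord0 mul0r set_itv1 Rintegral_set1.
rewrite big_ord_recr/= -IH addrC; apply/eqP; rewrite -subr_eq; apply/eqP.
rewrite (@Rintegral_itvB R g (BLeft 0) (BRight _) (k%:R / p%:R))//.
- rewrite Rintegral_itv_obnd_cbnd//.
  apply: integrableS (gi (k%:R / p%:R) (k.+1%:R / p%:R)) => //.
  exact: subset_itv_oc_cc.
- by rewrite bnd_simp divr_ge0.
- by rewrite bnd_simp ler_pM2r ?invr_gt0// ler_nat.
Qed.

(** Each cell integral is a value of [g] inside the cell times [1 / p]; [quadratic_modulus] on
    [[-1, 1]] serves as uniform continuity. *)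
Lemma riemann_sum_cvg (g : R -> R) (M : R) : continuous g -> (forall x, `|g x| <= M) ->
  (fun p : nat => p%:R^-1 * \sum_(k < p) g (k%:R / p%:R)) @ \oo -->
  \int[lebesgue_measure]_(t in `[0, 1]) g t.
Proof.
move=> gc gM; apply/cvgrPdist_le => e e0.
have [K K0 gK] := @quadratic_modulus g M 1 (e / 2) gc gM ltac:(lra).
have [N _ HN] : \forall p \near \oo, 2 * K / e <= p%:R.
  exact: nbhs_infty_ger.
exists (maxn N 1) => // p /=; rewrite geq_max => /andP[Np p0].
have p0R : 0 < p%:R :> R by rewrite ltr0n.
have p1R : 1 <= p%:R :> R by rewrite ler1n.
have {HN} := HN _ Np; rewrite /= ler_pdivrMr// => HN.
rewrite (Rintegral_split gc p0) mulr_sumr -sumrB.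
apply: le_trans (ler_norm_sum _ _ _) _.
have -> : e = \sum_(k < p) (e / p%:R).
  by rewrite sumr_const card_ord -[RHS]mulr_natr divfK// gt_eqF.
apply: ler_sum => k _.
have kk : k%:R / p%:R < k.+1%:R / p%:R :> R by rewrite ltr_pM2r ?invr_gt0// ltr_nat.
have [c /andP[c1 c2] ->] := MVT_integral gc kk.
have E : k.+1%:R / p%:R - k%:R / p%:R = p%:R^-1 :> R.
  by rewrite -mulrBl -natrB// subSnn mul1r.
rewrite E [p%:R^-1 * g _]mulrC -mulrBl normrM [X in _ * X]gtr0_norm ?invr_gt0//.
rewrite ler_pM2r ?invr_gt0//.
apply: le_trans (gK _ _ _) _.
  by rewrite ger0_norm ?divr_ge0// ler_pdivrMr// mul1r ler_nat ltnW.
suff : K * (c - k%:R / p%:R) ^+ 2 <= e / 2 by lra.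
(* The crude bound [1 / p] instead of [1 / p^2] suffices, since [p >= 2 * K / e]. *)
have : (c - k%:R / p%:R) ^+ 2 <= p%:R^-1.
  have aux (u v : R) : 0 < u < v -> v <= 1 -> u ^+ 2 <= v by nra.
  by apply: aux; [rewrite -E; lra|rewrite invf_le1].
move=> /(ler_wpM2l K0)/le_trans; apply.
by rewrite ler_pdivrMr//; lra.
Qed.

End quad.

(** * Cosine series with absolutely summable coefficients *)

Section summable.
Variables (R : realType) (r : nat -> R) (Mr : R).
Hypothesis hr : forall N, \sum_(l < N) `|r l| <= Mr.

Lemma summable_coef_le d : `|r d| <= Mr.
Proof.
apply: le_trans (hr d.+1); rewrite big_ord_recr/= lerDr.
by apply: sumr_ge0.
Qed.

(** The bound does not depend on [m], so one compact set contains all circulant eigenvalues before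
    [m] is chosen. *)
Lemma trig_poly_bound m t : `|trig_poly m r t| <= 2 * Mr.
Proof.
apply: le_trans (_ : 2 * \sum_(l < m.+1) `|r l| <= _); last by rewrite ler_pM2l.
rewrite big_ord_recl/= mulrDr; apply: le_trans (ler_normD _ _) _.
apply: lerD; first by rewrite ler_peMl// ler1n.
rewrite mulr_sumr; apply: le_trans (ler_norm_sum _ _ _) _.
apply: ler_sum => l _; rewrite /bump/= add1n !normrM normr_nat mulrC -[leLHS]mulrA ler_pM2l//.
by rewrite mulrC ler_piMr// ler_norml cos_geN1 cos_le1.
Qed.

Lemma trig_poly_is_cvg t : cvgn (fun m => trig_poly m r t).
Proof.
pose u l := r l.+1 * (2 * cos (2 * pi * l.+1%:R * t)).
suff /cvg_ex[l ul] : cvgn (series u).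
  apply/cvg_ex; exists (r 0%N + l); apply: cvgD; first exact: cvg_cst.
  rewrite (_ : (fun _ => _) = series u)//.
  by apply/funext => m; rewrite /series/= big_mkord.
apply: normed_cvg; apply: nondecreasing_is_cvgn.
  by move=> a b ab; apply: nondecreasing_series => // *; exact: normr_ge0.
exists (2 * Mr) => _ [m _ <-].
have -> : [normed series u] m = \sum_(0 <= l < m) `|u l| by [].
rewrite big_mkord; apply: le_trans (_ : 2 * \sum_(l < m.+1) `|r l| <= _);
  last by rewrite ler_pM2l.
rewrite big_ord_recl/= mulrDr -[leLHS]add0r; apply: lerD; first by rewrite mulr_ge0.
rewrite mulr_sumr.
apply: ler_sum => l _; rewrite /u /bump/= add1n !normrM normr_nat mulrC -[leLHS]mulrA ler_pM2l//.
by rewrite mulrC ler_piMr// ler_norml cos_geN1 cos_le1.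
Qed.

Lemma trig_poly_continuous m : continuous (trig_poly m r).
Proof.
move=> t; apply: cvgD; first exact: cvg_cst.
have -> : (fun x : R => \sum_(l < m) r l.+1 * (2 * cos (2 * pi * l.+1%:R * x))) =
   \sum_(l < m) (fun x => r l.+1 * (2 * cos (2 * pi * l.+1%:R * x))).
  by apply/funext => x; rewrite fct_sumE.
rewrite [X in _ --> X](_ : _ =
  (\sum_(l < m) (fun x => r l.+1 * (2 * cos (2 * pi * l.+1%:R * x)))) t);
  last by rewrite fct_sumE.
apply: (big_ind (fun F : R -> R => {for t, continuous F})).
- exact: cst_continuous.
- by move=> F G Fc Gc; apply: continuousD.
- move=> l _; apply: cvgM; first exact: cvg_cst.
  apply: cvgM; first exact: cvg_cst.
  apply: (continuous_comp (f := fun x => 2 * pi * l.+1%:R * x)); last exact: continuous_cos.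
  by apply: cvgM; [exact: cvg_cst|exact: cvg_id].
Qed.

(** The squares are summable because [r d ^+ 2 <= Mr * |r d|]; the tail is at most the limit minus
    the partial sum up to [m] included. *)
Lemma sqr_tail_small e : 0 < e -> \forall m \near \oo, forall p,
  \sum_(d < p) (m < d)%N%:R * r d ^+ 2 <= e.
Proof.
move=> e0.
have Mr0 : 0 <= Mr by apply: le_trans (hr 0); rewrite big_ord0.
pose s := series (fun d => r d ^+ 2).
have snd : {homo s : n m / (n <= m)%N >-> n <= m}.
  by move=> a b ab; apply: nondecreasing_series => // *; exact: sqr_ge0.
have sc : cvgn s.
  apply: nondecreasing_is_cvgn => //; exists (Mr * Mr) => _ [m _ <-].
  rewrite /s /series/= big_mkord.
  apply: le_trans (_ : Mr * \sum_(l < m) `|r l| <= _); last by rewrite ler_wpM2l.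
  rewrite mulr_sumr; apply: ler_sum => l _.
  by rewrite -real_normK ?num_real// expr2 ler_wpM2r// summable_coef_le.
have /cvgrPdist_le/(_ _ e0)[N _ HN] := sc.
exists N => // m /= Nm p.
have [mp|pm] := ltnP m p; last first.
  rewrite big1 ?ltW// => d _; rewrite (_ : (m < d)%N = false) ?mul0r//.
  by have := ltn_ord d; lia.
apply: (@le_trans _ _ (s p - s m.+1)).
  rewrite /s sub_series_geq//.
  rewrite -(big_mkord xpredT (fun d => (m < d)%N%:R * r d ^+ 2)).
  rewrite (@big_cat_nat _ _ _ m.+1)//=.
  rewrite big_nat big1 ?add0r; last first.
    by move=> d /andP[_]; rewrite ltnS leqNgt => /negbTE ->; rewrite mul0r.
  rewrite big_nat [leRHS]big_nat; apply: ler_sum => d /andP[-> _]; rewrite mul1r//.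
apply: le_trans (_ : limn s - s m.+1 <= _).
  by rewrite lerB// nondecreasing_cvgn_le.
by apply: le_trans (HN m.+1 _); [exact: ler_norm|rewrite /=; lia].
Qed.

(** Dominated convergence on [[0, 1]] with the constant bound [M]. *)
Lemma integral_trig_poly_cvg (f : R -> R) (M : R) :
  continuous f -> (forall x, `|f x| <= M) ->
  (fun m => \int[lebesgue_measure]_(t in `[0, 1]) f (trig_poly m r t)) @ \oo -->
  fine (\int[lebesgue_measure]_(t in `[0%R, 1%R]) (f (limn (fun m => trig_poly m r t)))%:E).
Proof.
move=> fc fM; pose D : set R := [set` `[0, 1]].
have mf m : measurable_fun D (EFin \o (fun t => f (trig_poly m r t))).
  apply/measurable_EFinP; apply: measurable_funTS.
  apply: measurable_realfun.continuous_measurable_fun => t.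
  apply: continuous_comp; first exact: trig_poly_continuous.
  exact: fc.
have ff (t : R) : D t -> (EFin \o (fun t => f (trig_poly m r t))) t @[m --> \oo] -->
    (f (limn (fun m => trig_poly m r t)))%:E.
  move=> _; apply: cvg_EFin; first exact: nearW.
  apply: (@cvg_comp _ _ _ (fun m => trig_poly m r t) f); last exact: fc.
  exact: trig_poly_is_cvg.
have ig : lebesgue_measure.-integrable D (cst M%:E).
  apply: continuous_compact_integrable; first exact: segment_compact.
  by apply: continuous_subspaceT => x; exact: cst_continuous.
have fM' m t : D t -> (`|(EFin \o (fun t => f (trig_poly m r t))) t| <= cst M%:E t)%E.
  by move=> _; rewrite /= lee_fin.
have mD : measurable D by exact: measurable_itv.
have ml := emeasurable_fun_cvg _ _ mf ff.
have aff := @aeW _ _ R lebesgue_measure _ ff.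
have ab := @aeW _ _ R lebesgue_measure _ (fun t m => fM' m t).
have [il _ ic] := @dominated_convergence _ _ R lebesgue_measure D mD _ _ _ mf ml aff ig ab.
by apply: fine_cvg; rewrite fineK//; exact: integrable_fin_num.
Qed.

End summable.

(** * Joint laws and independence *)

Section laws.
Context {d : measure_display} {T : measurableType d} {R : realType}.
Variable P : probability T R.

Definition rv_of d1 (T1 : measurableType d1) (V : T -> T1)
  (mV : measurable_fun setT V) : {mfun T >-> T1} :=
  MeasurableFun.Pack (MeasurableFun.Class (isMeasurableFun.Build _ _ _ _ V mV)).

(** Splitting into positive and negative parts avoids any integrability assumption on [h]. *)
Lemma integral_same_law d1 (T1 : measurableType d1) (V W : T -> T1) (h : T1 -> \bar R) :
  measurable_fun setT V -> measurable_fun setT W -> measurable_fun setT h ->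
  (forall A, measurable A -> P (V @^-1` A) = P (W @^-1` A)) ->
  (\int[P]_w h (V w) = \int[P]_w h (W w))%E.
Proof.
move=> mV mW mh VW.
have ge0 (g : T1 -> \bar R) : measurable_fun setT g -> (forall x, 0 <= g x)%E ->
    (\int[P]_w g (V w) = \int[P]_w g (W w))%E.
  move=> mg g0.
  have := ge0_integral_distribution (rv_of mV : {RV P >-> T1}) mg g0 => /= <-.
  have := ge0_integral_distribution (rv_of mW : {RV P >-> T1}) mg g0 => /= <-.
  by apply: eq_measure_integral => A mA _; exact: VW.
rewrite -[LHS]/(\int[P]_w (h \o V) w)%E -[RHS]/(\int[P]_w (h \o W) w)%E.
rewrite integralE [RHS]integralE (funepos_comp h V) (funepos_comp h W).
rewrite (funeneg_comp h V) (funeneg_comp h W); congr (_ - _)%E.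
  by apply: ge0 => //; exact: measurable_funepos.
by apply: ge0 => //; exact: measurable_funeneg.
Qed.

Definition rectangles d1 d2 (T1 : measurableType d1) (T2 : measurableType d2) :
  set (set (T1 * T2)) := [set A `*` B | A in measurable & B in measurable].

Lemma rectangles_setI_closed d1 d2 (T1 : measurableType d1) (T2 : measurableType d2) :
  setI_closed (@rectangles _ _ T1 T2).
Proof.
move=> _ _ [A mA [B mB <-]] [A' mA' [B' mB' <-]].
exists (A `&` A'); first exact: measurableI.
by exists (B `&` B'); [exact: measurableI|rewrite setXI].
Qed.

Lemma rectangles_setT d1 d2 (T1 : measurableType d1) (T2 : measurableType d2) :
  rectangles (setT : set (T1 * T2)).
Proof. by exists setT => //; exists setT => //; rewrite setXTT. Qed.

(** Uniqueness of finite measures on a generating pi-system that contains the whole space. *)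
Lemma probability_unique d1 (T1 : measurableType d1) (G : set (set T1))
    (m1 m2 : {measure set T1 -> \bar R}) :
  measurable = <<s G >> -> setI_closed G -> G setT ->
  (m1 setT < +oo)%E -> (forall A, G A -> m1 A = m2 A) ->
  forall A, measurable A -> m1 A = m2 A.
Proof.
move=> mG GI GT fin H A mA.
apply: (@measure_unique _ R T1 G (fun=> setT) mG GI _ _ m1 m2 H) => //.
by rewrite bigcup_const.
Qed.

Lemma joint_law_eq d1 d2 (T1 : measurableType d1) (T2 : measurableType d2)
    (X X' : T -> T1) (Y Y' : T -> T2) :
  measurable_fun setT X -> measurable_fun setT X' ->
  measurable_fun setT Y -> measurable_fun setT Y' ->
  (forall A B, measurable A -> measurable B ->
     P (X @^-1` A `&` Y @^-1` B) = P (X' @^-1` A `&` Y' @^-1` B)) ->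
  forall D, measurable D ->
    P ((fun w => (X w, Y w)) @^-1` D) = P ((fun w => (X' w, Y' w)) @^-1` D).
Proof.
move=> mX mX' mY mY' H.
have mXY := measurable_fun_pair mX mY.
have mXY' := measurable_fun_pair mX' mY'.
apply: (@probability_unique _ _ (@rectangles _ _ T1 T2)
  (distribution P (rv_of mXY)) (distribution P (rv_of mXY'))).
- exact: measurable_prod_measurableType.
- exact: rectangles_setI_closed.
- exact: rectangles_setT.
- rewrite /= /distribution /pushforward preimage_setT. by rewrite probability_setT ltry.

- by move=> _ [A mA [B mB <-]]; exact: H.
Qed.

(** With [E] fixed, both sides are finite measures in [B]: the law of [Y] restricted to [E], and the
    law of [Y] scaled by [P E]. *)
Lemma independent_extend d2 (T2 : measurableType d2) (E : set T) (G : set (set T2))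
    (Y : T -> T2) :
  measurable E -> measurable_fun setT Y ->
  measurable = <<s G >> -> setI_closed G -> G setT ->
  (forall B, G B -> P (E `&` Y @^-1` B) = (P E * P (Y @^-1` B))%E) ->
  forall B, measurable B -> P (E `&` Y @^-1` B) = (P E * P (Y @^-1` B))%E.
Proof.
move=> mE mY mG GI GT H B mB.
have PEf : P E \is a fin_num by exact: fin_num_measure.
pose mu1' : {measure set T2 -> \bar R} := pushforward (mrestr P mE) (rv_of mY).
pose mu1 := mu1' mY.
pose mu2 : {measure set T2 -> \bar R} :=
  mscale (NngNum (fine_ge0 (measure_ge0 P E))) (distribution P (rv_of mY)).
have mu1E A : mu1 A = P (Y @^-1` A `&` E) by [].
have mu2E A : mu2 A = (P E * P (Y @^-1` A))%E.
  by rewrite /mu2/= /mscale/= fineK.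
rewrite -mu2E setIC -mu1E; apply: (probability_unique mG GI GT) => //.
  by rewrite mu1E preimage_setT setTI (le_lt_trans (probability_le1 _ _))// ltry.
by move=> A GA; rewrite mu1E mu2E setIC H.
Qed.

(** Independence says that the joint law is the product of the marginals; Fubini then factors the
    integral. *)
Lemma expectation_mul_independent (X Y : T -> R) :
  measurable_fun setT X -> measurable_fun setT Y ->
  (forall A B, measurable A -> measurable B ->
     P (X @^-1` A `&` Y @^-1` B) = (P (X @^-1` A) * P (Y @^-1` B))%E) ->
  P.-integrable setT (EFin \o X) -> P.-integrable setT (EFin \o Y) ->
  P.-integrable setT (EFin \o (fun w => X w * Y w)) ->
  (\int[P]_w (X w * Y w)%:E = (\int[P]_w (X w)%:E) * (\int[P]_w (Y w)%:E))%E.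
Proof.
move=> mX mY H iX iY iXY.
have mXY := measurable_fun_pair mX mY.
pose X' : {RV P >-> R} := rv_of mX; pose Y' : {RV P >-> R} := rv_of mY.
pose XY' := (rv_of mXY).
pose h (z : R * R) : \bar R := (z.1 * z.2)%:E.
have mh : measurable_fun setT h.
  by apply/measurable_EFinP; apply: measurable_funM; [exact: measurable_fst|exact: measurable_snd].
have PE : forall D, measurable D ->
    (distribution P X' \x distribution P Y')%E D = distribution P XY' D.
  by apply: product_measure_unique => A B mA mB; exact: H.
have ih : (distribution P XY').-integrable setT h by exact: integrable_pushforward.
have ih' : (distribution P X' \x distribution P Y')%E.-integrable setT h.
  apply/integrableP; split => //; have /integrableP[_] := ih.
  congr (_ < _)%E; apply: eq_measure_integral => A mA _; exact/esym/PE.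
transitivity (\int[distribution P XY']_z h z)%E.
  by rewrite integral_distribution.
transitivity (\int[distribution P X' \x distribution P Y']_z h z)%E.
  by apply: eq_measure_integral => A mA _; exact/esym/PE.
rewrite -integral12_prod_meas1//.
have iY' : (distribution P Y').-integrable setT (EFin : R -> \bar R) by exact: integrable_pushforward.
have iX' : (distribution P X').-integrable setT (EFin : R -> \bar R) by exact: integrable_pushforward.
have EY : (\int[distribution P Y']_y y%:E = \int[P]_w (Y w)%:E)%E.
  by rewrite integral_distribution.
have EX : (\int[distribution P X']_y y%:E = \int[P]_w (X w)%:E)%E.
  by rewrite integral_distribution.
rewrite -EX -EY.
have fY : (\int[distribution P Y']_y y%:E)%E \is a fin_num by exact: integrable_fin_num.
rewrite -(fineK fY) -integralZr//.
apply: eq_integral => x _; rewrite /fubini_F /h /=.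
under eq_integral do rewrite EFinM.
by rewrite integralZl// fineK.
Qed.

End laws.

(** * Square-integrable random variables *)

Section moments.
Context {d : measure_display} {T : measurableType d} {R : realType}.
Variable P : probability T R.
Implicit Types X Y : T -> R.

Definition square_integrable X :=
  measurable_fun setT X /\ P.-integrable setT (EFin \o (fun w => X w ^+ 2)).

Lemma le_integrableR X Y : measurable_fun setT X ->
  (forall w, `|X w| <= Y w) -> P.-integrable setT (EFin \o Y) ->
  P.-integrable setT (EFin \o X).
Proof.
move=> mX XY iY; apply: (le_integrable measurableT _ _ iY).
  exact/measurable_EFinP.
by move=> w _ /=; rewrite lee_fin (le_trans (XY w))// ler_norm.
Qed.

Lemma integrableDR X Y : P.-integrable setT (EFin \o X) ->
  P.-integrable setT (EFin \o Y) -> P.-integrable setT (EFin \o (fun w => X w + Y w)).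
Proof. by move=> iX iY; have := integrableD measurableT iX iY. Qed.

Lemma square_integrable_mul X Y : square_integrable X -> square_integrable Y ->
  P.-integrable setT (EFin \o (fun w => X w * Y w)).
Proof.
move=> [mX iX] [mY iY]; apply: le_integrableR (integrableDR iX iY).
  exact: measurable_funM.
move=> w; rewrite ler_norml; apply/andP; split.
  by have := sqr_ge0 (X w + Y w); have := sqr_ge0 (X w); have := sqr_ge0 (Y w); nra.
by have := sqr_ge0 (X w - Y w); have := sqr_ge0 (X w); have := sqr_ge0 (Y w); nra.
Qed.

Lemma square_integrable_cst a : square_integrable (fun=> a).
Proof.
split; first exact: measurable_cst.
exact: (finite_measure_integrable_cst P (a ^+ 2)).
Qed.

Lemma square_integrable1 X : square_integrable X -> P.-integrable setT (EFin \o X).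
Proof.
move=> iX; have := square_integrable_mul iX (square_integrable_cst 1).
by under [fun w => _ * _]eq_fun do rewrite mulr1.
Qed.

Lemma square_integrableD X Y : square_integrable X -> square_integrable Y ->
  square_integrable (fun w => X w + Y w).
Proof.
move=> iX iY; have [mX i2X] := iX; have [mY i2Y] := iY.
split; first exact: measurable_funD.
have iXY := square_integrable_mul iX iY.
have := integrableDR (integrableDR i2X i2Y) (integrableDR iXY iXY).
apply: le_integrableR; first by apply: measurable_funX; exact: measurable_funD.
by move=> w; rewrite ger0_norm ?sqr_ge0//; nra.
Qed.

Lemma ExD X Y : P.-integrable setT (EFin \o X) -> P.-integrable setT (EFin \o Y) ->
  Ex P (fun w => X w + Y w) = Ex P X + Ex P Y.
Proof. exact: RintegralD. Qed.

Lemma ExZ a X : P.-integrable setT (EFin \o X) ->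
  Ex P (fun w => a * X w) = a * Ex P X.
Proof. by move=> iX; have := RintegralZl a measurableT iX. Qed.

Lemma Ex_cst a : Ex P (fun=> a) = a.
Proof.
have := Rintegral_cst P measurableT a.
by rewrite /= probability_setT mulr1 => E; exact: E.
Qed.

Lemma Ex_le X Y : P.-integrable setT (EFin \o X) -> P.-integrable setT (EFin \o Y) ->
  (forall w, X w <= Y w) -> Ex P X <= Ex P Y.
Proof. by move=> iX iY XY; apply: le_Rintegral. Qed.

Lemma Ex_sum n (X : 'I_n -> T -> R) :
  (forall k, P.-integrable setT (EFin \o X k)) ->
  Ex P (fun w => \sum_k X k w) = \sum_k Ex P (X k).
Proof.
move=> iX; rewrite /Ex.
under eq_integral do rewrite -sumEFin.
rewrite (integral_sum measurableT iX).
rewrite sum_fine// => k _.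
exact: (integrable_fin_num measurableT (iX k)).
Qed.

Lemma integrable_sumR n (X : 'I_n -> T -> R) :
  (forall k, P.-integrable setT (EFin \o X k)) ->
  P.-integrable setT (EFin \o (fun w => \sum_k X k w)).
Proof.
move=> iX; have := @integrable_sum _ _ _ P setT measurableT _ (index_enum 'I_n)
  xpredT (fun i => EFin \o X i) (fun i _ => iX i).
by congr integrable; apply/funext => w /=; rewrite sumEFin.
Qed.

Lemma integrableZR a X : P.-integrable setT (EFin \o X) ->
  P.-integrable setT (EFin \o (fun w => a * X w)).
Proof. by move=> iX; have := integrableZl measurableT a iX. Qed.

Lemma Ex_sqr_subr X a : square_integrable X -> Ex P X = a ->
  Ex P (fun w => (X w - a) ^+ 2) = Ex P (fun w => X w ^+ 2) - a ^+ 2.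
Proof.
move=> iX Xa; have i1 := square_integrable1 iX; have [_ i2] := iX.
have iC b := square_integrable1 (square_integrable_cst b).
have -> : (fun w => (X w - a) ^+ 2) = (fun w => X w ^+ 2 + ((- 2 * a) * X w + a ^+ 2)).
  by apply/funext => w; ring.
rewrite !ExD ?ExZ ?Ex_cst ?Xa//; first by ring.
- exact: integrableZR.
- by apply: integrableDR => //; exact: integrableZR.
Qed.

Lemma Ex_mul_subr X Y a : square_integrable X -> square_integrable Y ->
  Ex P X = a -> Ex P Y = a -> Ex P (fun w => X w * Y w) = a ^+ 2 ->
  Ex P (fun w => (X w - a) * (Y w - a)) = 0.
Proof.
move=> iX iY Xa Ya XY; have i1 := square_integrable1 iX; have i2 := square_integrable1 iY.
have iC b := square_integrable1 (square_integrable_cst b).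
have i12 := square_integrable_mul iX iY.
have -> : (fun w => (X w - a) * (Y w - a)) =
    (fun w => X w * Y w + ((- a) * X w + ((- a) * Y w + a ^+ 2))).
  by apply/funext => w; ring.
have iZ b W : P.-integrable setT (EFin \o W) -> P.-integrable setT (EFin \o (fun w => b * W w)).
  exact: integrableZR.
rewrite ExD//; last by do ?apply: integrableDR => //; apply: iZ.
rewrite ExD//; [|exact: iZ|by apply: integrableDR => //; exact: iZ].
rewrite ExD ?ExZ ?Ex_cst ?Xa ?Ya ?XY//; last exact: iZ.
by ring.
Qed.

(** After centring, only the [n] diagonal terms of the double sum survive, each at most [c], against
    the factor [1 / n^2]. *)
Lemma mean_uncorrelated n (X : 'I_n -> T -> R) a c : (0 < n)%N ->
  (forall k, square_integrable (X k)) -> (forall k, Ex P (X k) = a) ->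
  (forall k, Ex P (fun w => X k w ^+ 2) <= c) ->
  (forall k l, k != l -> Ex P (fun w => X k w * X l w) = a ^+ 2) ->
  Ex P (fun w => (n%:R^-1 * \sum_k X k w - a) ^+ 2) <= c / n%:R.
Proof.
move=> n0 iX Xa Xc Xkl.
have n0R : 0 < n%:R :> R by rewrite ltr0n.
pose W k w := X k w - a.
have iW k : square_integrable (W k).
  exact: (square_integrableD (iX k) (square_integrable_cst (- a))).
have iWW k l := square_integrable_mul (iW k) (iW l).
have -> : (fun w => (n%:R^-1 * \sum_k X k w - a) ^+ 2) =
    (fun w => n%:R^-1 ^+ 2 * \sum_k \sum_l W k w * W l w).
  apply/funext => w; under [in RHS]eq_bigr do rewrite -mulr_sumr.
  rewrite -mulr_suml -expr2 -exprMn; congr (_ ^+ 2).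
  by rewrite sumrB mulrBr sumr_const card_ord -[a *+ n]mulr_natl mulKf ?gt_eqF.
rewrite ExZ; last by apply: integrable_sumR => k; exact: integrable_sumR.
rewrite Ex_sum; last by move=> k; exact: integrable_sumR.
have H k : Ex P (fun w => \sum_l W k w * W l w) <= c.
  rewrite Ex_sum// (bigD1 k)//= [X in _ + X]big1 ?addr0.
    have -> : Ex P (fun w => W k w * W k w) = Ex P (fun w => (X k w - a) ^+ 2) by [].
    by rewrite Ex_sqr_subr// lerBlDr (le_trans (Xc k))// lerDl sqr_ge0.
  by move=> l lk; apply: Ex_mul_subr => //; rewrite Xkl// eq_sym.
have : \sum_k Ex P (fun w => \sum_l W k w * W l w) <= n%:R * c.
  rewrite mulr_natl -[n in c *+ n]card_ord -sumr_const.
  by apply: ler_sum => k _; exact: H.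
move=> /(ler_wpM2l (sqr_ge0 n%:R^-1))/le_trans; apply.
by rewrite expr2 -mulrA mulKf ?gt_eqF// mulrC.
Qed.

End moments.

(** * The process and its copies *)

Section process.
Context {d : measure_display} {T : measurableType d} {R : realType}.
Variable P : probability T R.
Variables (Z : int -> T -> R) (Zc : nat -> int -> T -> R).
Hypotheses (hZ : assumptionZ P Z) (hcop : iid_copies P Z Zc).

Lemma cyl2 (Y : int -> T -> R) i j A B :
  cyl Y [:: (i, A); (j, B)] = Y i @^-1` A `&` Y j @^-1` B.
Proof.
apply/seteqP; split => w /=.
  move=> h; split; first by apply: (h (i, A)); rewrite !inE eqxx.
  by apply: (h (j, B)); rewrite !inE eqxx orbT.
by move=> [h1 h2] q; rewrite !inE => /orP[]/eqP ->.
Qed.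

Lemma meas_spec2 (i j : int) (A B : set R) : measurable A -> measurable B ->
  meas_spec [:: (i, A); (j, B)].
Proof. by move=> mA mB q; rewrite !inE => /orP[]/eqP ->. Qed.

Let mZ j : measurable_fun setT (Z j). Proof. by have [] := hZ. Qed.
Let mZc i j : measurable_fun setT (Zc i j). Proof. by have [] := hcop. Qed.

Lemma stationary_pair (k i j : int) A B : measurable A -> measurable B ->
  P (Z (i + k) @^-1` A `&` Z (j + k) @^-1` B) = P (Z i @^-1` A `&` Z j @^-1` B).
Proof.
move=> mA mB; have [_ [+ _]] := hZ => /(_ k _ (@meas_spec2 i j _ _ mA mB)).
by rewrite /= !cyl2.
Qed.

Lemma copy_pair k i j A B : (0 < k)%N -> measurable A -> measurable B ->
  P (Zc k i @^-1` A `&` Zc k j @^-1` B) = P (Z i @^-1` A `&` Z j @^-1` B).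
Proof.
move=> k0 mA mB; have [_ [+ _]] := hcop => /(_ k _ k0 (@meas_spec2 i j _ _ mA mB)).
by rewrite /= !cyl2.
Qed.

(** The independence hypothesis for two copies, with one two-coordinate cylinder for each. *)
Lemma copy_independent k l i j A B A' B' : (0 < k)%N -> (0 < l)%N -> k != l ->
  measurable A -> measurable B -> measurable A' -> measurable B' ->
  P ((Zc k i @^-1` A `&` Zc k j @^-1` B) `&` (Zc l i @^-1` A' `&` Zc l j @^-1` B')) =
  (P (Zc k i @^-1` A `&` Zc k j @^-1` B) * P (Zc l i @^-1` A' `&` Zc l j @^-1` B'))%E.
Proof.
move=> k0 l0 kl mA mB mA' mB'.
have [_ [_ H]] := hcop.
pose idx (x : 'I_2) := if x == ord0 then k else l.
pose S (x : 'I_2) := if x == ord0 then [:: (i, A); (j, B)] else [:: (i, A'); (j, B')].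
have := H 2%N idx S.
rewrite big_ord_recl big_ord1 /idx /S /= !cyl2 => <-.
- congr (P _); apply/seteqP; split => w /=.
    by move=> [h1 h2] x; case: eqP => _; rewrite cyl2.
  move=> h; have := h ord0; have := h (lift ord0 ord0).
  by rewrite /= !cyl2.
- move=> x y; case: eqP => [->|/eqP x0]; case: eqP => [->|/eqP y0] //.
  + by move=> /eqP; rewrite (negbTE kl).
  + by move=> /eqP; rewrite eq_sym (negbTE kl).
  + by move=> _; apply/val_inj; move: x y x0 y0 => [[|[|//]] ?] [[|[|//]] ?].
- by move=> x; case: ifP.
- by move=> x; case: ifP => _; exact: meas_spec2.
Qed.

Let int_prod (h : R * R -> \bar R) (mh : measurable_fun setT h) k i j : (0 < k)%N ->
  (\int[P]_w h (Zc k i w, Zc k j w) = \int[P]_w h (Z i w, Z j w))%E.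
Proof.
move=> k0; apply: (@integral_same_law _ _ _ _ _ _
  (fun w => (Zc k i w, Zc k j w)) (fun w => (Z i w, Z j w)) h) => //.
- exact: measurable_fun_pair.
- exact: measurable_fun_pair.
- by apply: joint_law_eq => // A B mA mB; exact: copy_pair.
Qed.

Let int_shift (h : R * R -> \bar R) (mh : measurable_fun setT h) k i j :
  (\int[P]_w h (Z (i + k) w, Z (j + k) w) = \int[P]_w h (Z i w, Z j w))%E.
Proof.
apply: (@integral_same_law _ _ _ _ _ _
  (fun w => (Z (i + k) w, Z (j + k) w)) (fun w => (Z i w, Z j w)) h) => //.
- exact: measurable_fun_pair.
- exact: measurable_fun_pair.
- by apply: joint_law_eq => // A B mA mB; exact: stationary_pair.
Qed.

Definition fourth_moment : R := Ex P (fun w => Z 0 w ^+ 4).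

Let m1 n : measurable_fun setT (fun z : R * R => (z.1 ^+ n)%:E).
Proof. by apply/measurable_EFinP; apply: measurable_funX; exact: measurable_fst. Qed.

Let m2 : measurable_fun setT (fun z : R * R => (z.1 * z.2)%:E).
Proof.
by apply/measurable_EFinP; apply: measurable_funM; [exact: measurable_fst|exact: measurable_snd].
Qed.

Lemma integrable_Z0_pow4 : P.-integrable setT (EFin \o (fun w => Z 0 w ^+ 4)).
Proof.
have [_ [_ [/(_ 4%N isT) i4 _]]] := hZ.
apply: le_integrableR i4; first exact: measurable_funX.
by move=> w; rewrite normrX.
Qed.

Lemma integral_Zc_pow4 k i : (0 < k)%N ->
  (\int[P]_w (Zc k i w ^+ 4)%:E = fourth_moment%:E)%E.
Proof.
(* A pair with equal indices reduces a one-coordinate moment to the pair laws; the shift by [i] then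
   brings it to [Z 0]. *)
move=> k0; rewrite (int_prod (m1 4) i i k0)/=.
have := int_shift (m1 4) i 0 0; rewrite /= add0r => ->.
by rewrite /fourth_moment /Ex fineK//; apply: integrable_fin_num => //; exact: integrable_Z0_pow4.
Qed.

Lemma integrable_pow4 (X : T -> R) : measurable_fun setT X ->
  (\int[P]_w (X w ^+ 4)%:E = fourth_moment%:E)%E ->
  P.-integrable setT (EFin \o (fun w => X w ^+ 4)).
Proof.
move=> mX EX; apply/integrableP; split.
  by apply/measurable_EFinP; exact: measurable_funX.
under eq_integral do rewrite gee0_abs ?lee_fin ?exprn_even_ge0//.
by rewrite EX ltry.
Qed.

(** From [(X Y)^2 <= (X^4 + Y^4) / 2]; this is where the fourth moment enters. *)
Lemma square_integrable_mul4 (X Y : T -> R) :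
  measurable_fun setT X -> measurable_fun setT Y ->
  (\int[P]_w (X w ^+ 4)%:E = fourth_moment%:E)%E ->
  (\int[P]_w (Y w ^+ 4)%:E = fourth_moment%:E)%E ->
  square_integrable P (fun w => X w * Y w) /\
  Ex P (fun w => (X w * Y w) ^+ 2) <= fourth_moment.
Proof.
move=> mX mY EX EY; have iX := integrable_pow4 mX EX; have iY := integrable_pow4 mY EY.
have iXY := integrableZR 2^-1 (integrableDR iX iY).
have le w : (X w * Y w) ^+ 2 <= 2^-1 * (X w ^+ 4 + Y w ^+ 4).
  have := sqr_ge0 (X w ^+ 2 - Y w ^+ 2); nra.
have iS : P.-integrable setT (EFin \o (fun w => (X w * Y w) ^+ 2)).
  apply: le_integrableR iXY; first by apply: measurable_funX; exact: measurable_funM.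
  by move=> w; rewrite ger0_norm ?sqr_ge0.
split; first by split => //; exact: measurable_funM.
apply: (le_trans (Ex_le iS iXY le)).
rewrite ExZ; last exact: integrableDR.
rewrite ExD// /Ex EX EY /=; lra.
Qed.

Lemma Ex_Z0 : Ex P (Z 0) = 0.
Proof. by have [_ [_ [_ [E _]]]] := hZ; rewrite /Ex E. Qed.

Lemma autocovE j : autocov P Z j = Ex P (fun w => Z 0 w * Z j w).
Proof. by rewrite /autocov Ex_Z0 mul0r subr0. Qed.

Lemma Ex_copy_mul k i j : (0 < k)%N ->
  Ex P (fun w => Zc k i w * Zc k j w) = autocov P Z (j - i).
Proof.
move=> k0; rewrite autocovE /Ex; congr fine.
rewrite (int_prod m2 i j k0)/=.
by have := int_shift m2 i 0 (j - i); rewrite /= add0r subrK => ->.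
Qed.

(** Shifting by [j] carries the pair of times [0, -j] to [j, 0]. *)
Lemma autocovN j : autocov P Z (- j) = autocov P Z j.
Proof.
rewrite !autocovE /Ex; congr fine.
have := int_shift m2 j 0 (- j); rewrite /= add0r addNr => <-.
by under eq_integral do rewrite mulrC.
Qed.

Lemma Ex_copies_mul k l i j : (0 < k)%N -> (0 < l)%N -> k != l ->
  Ex P (fun w => (Zc k i w * Zc k j w) * (Zc l i w * Zc l j w)) = autocov P Z (j - i) ^+ 2.
Proof.
move=> k0 l0 kl.
have [sk _] := square_integrable_mul4 (mZc k i) (mZc k j)
  (integral_Zc_pow4 i k0) (integral_Zc_pow4 j k0).
have [sl _] := square_integrable_mul4 (mZc l i) (mZc l j)
  (integral_Zc_pow4 i l0) (integral_Zc_pow4 j l0).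
rewrite /Ex (@expectation_mul_independent _ _ _ P
  (fun w => Zc k i w * Zc k j w) (fun w => Zc l i w * Zc l j w)).
- rewrite fineM; try by apply: integrable_fin_num => //; exact: square_integrable1.
  by rewrite expr2; congr (_ * _); exact: Ex_copy_mul.
- exact: measurable_funM.
- exact: measurable_funM.
- move=> A B mA mB.
  pose V w := (Zc k i w, Zc k j w); pose W w := (Zc l i w, Zc l j w).
  have mV : measurable_fun setT V := measurable_fun_pair (mZc k i) (mZc k j).
  have mW : measurable_fun setT W := measurable_fun_pair (mZc l i) (mZc l j).
  pose mul (z : R * R) := z.1 * z.2.
  have mmul : measurable_fun setT mul.
    by apply: measurable_funM; [exact: measurable_fst|exact: measurable_snd].
  have mpre C : measurable C -> measurable (mul @^-1` C).
    by move=> mC; rewrite -[X in measurable X]setTI; exact: mmul.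
  have mVpre C : measurable C -> measurable (V @^-1` C).
    by move=> mC; rewrite -[X in measurable X]setTI; exact: mV.
  have mWpre C : measurable C -> measurable (W @^-1` C).
    by move=> mC; rewrite -[X in measurable X]setTI; exact: mW.
  (* Independence is known for rectangles only. It is extended to all events of the second pair
     here, then to all events of the first pair in [step2]; the product map pulls the required
     events back to these. *)
  have step1 : forall B', measurable B' -> forall A', rectangles A' ->
      P (V @^-1` A' `&` W @^-1` B') = (P (V @^-1` A') * P (W @^-1` B'))%E.
    move=> B' mB' _ [A1 mA1 [A2 mA2 <-]].
    apply: (independent_extend _ mW (measurable_prod_measurableType _ _)
      (@rectangles_setI_closed _ _ _ _) (@rectangles_setT _ _ _ _) _ mB').
      by apply: mVpre; exact: measurableX.
    by move=> _ [B1 mB1 [B2 mB2 <-]]; exact: copy_independent.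
  have step2 : forall A', measurable A' -> forall B', measurable B' ->
      P (V @^-1` A' `&` W @^-1` B') = (P (V @^-1` A') * P (W @^-1` B'))%E.
    move=> A' mA' B' mB'; rewrite setIC muleC.
    apply: (independent_extend _ mV (measurable_prod_measurableType _ _)
      (@rectangles_setI_closed _ _ _ _) (@rectangles_setT _ _ _ _) _ mA').
      exact: mWpre.
    by move=> C hC; rewrite setIC muleC; exact: step1.
  exact: (step2 _ (mpre _ mA) _ (mpre _ mB)).
- exact: square_integrable1.
- exact: square_integrable1.
- exact: square_integrable_mul.
Qed.

Lemma sample_cov_variance n i j : (0 < n)%N ->
  Ex P (fun w => (\sum_(k < n) (Zc k.+1 i w / Num.sqrt n%:R) * (Zc k.+1 j w / Num.sqrt n%:R)
     - autocov P Z (j - i)) ^+ 2) <= fourth_moment / n%:R.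
Proof.
move=> n0.
have -> : (fun w => (\sum_(k < n) (Zc k.+1 i w / Num.sqrt n%:R) * (Zc k.+1 j w / Num.sqrt n%:R)
     - autocov P Z (j - i)) ^+ 2) =
   (fun w => (n%:R^-1 * \sum_(k < n) Zc k.+1 i w * Zc k.+1 j w - autocov P Z (j - i)) ^+ 2).
  apply/funext => w; congr ((_ - _) ^+ 2); rewrite mulr_sumr; apply: eq_bigr => k _.
  by rewrite mulrACA -invfM -expr2 sqr_sqrtr ?ler0n// mulrC.
have iU (k : 'I_n) := square_integrable_mul4 (mZc k.+1 i) (mZc k.+1 j)
  (integral_Zc_pow4 i (ltn0Sn k)) (integral_Zc_pow4 j (ltn0Sn k)).
apply: mean_uncorrelated => // k.
- by have [] := iU k.
- exact: Ex_copy_mul.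
- by have [] := iU k.
- by move=> l kl; exact: Ex_copies_mul.
Qed.

End process.

(** * Second cumulants and summability of the autocovariances *)

(** Either the block of [ord0] contains the other index or it is a singleton. In the cumulant
    formula a singleton block contributes the factor [Ex P (X ord0)], which vanishes for centred
    variables. *)
Lemma partition_I2 (Q : {set {set 'I_2}}) :
  finset.partition Q [set: 'I_2]%SET -> Q = [set [set: 'I_2]]%SET \/ [set ord0]%SET \in Q.
Proof.
move=> /and3P[/eqP cQ tQ n0].
have : (ord0 : 'I_2) \in finset.cover Q by rewrite cQ finset.inE.
move=> /finset.bigcupP[B BQ B0].
have [B1|B1] := boolP ((lift ord0 ord0 : 'I_2) \in B).
  left; have BT : B = [set: 'I_2]%SET.
    apply/finset.setP => -[[|[|//]] h]; rewrite finset.inE.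
      by rewrite (_ : Ordinal h = ord0)//; apply/val_inj.
    by rewrite (_ : Ordinal h = lift ord0 ord0)//; apply/val_inj.
  apply/finset.setP => C; rewrite finset.inE; apply/idP/eqP => [CQ|->]; last by rewrite -BT.
  apply/eqP/negPn/negP => CB.
  have := finset.trivIsetP tQ C B CQ BQ; rewrite BT => /(_ CB).
  rewrite -finset.setI_eq0 finset.setIT => /eqP C0.
  by move: n0; rewrite -C0 CQ.
right; rewrite (_ : [set ord0]%SET = B)//.
apply/finset.setP => -[[|[|//]] h]; rewrite finset.inE.
  by rewrite (_ : Ordinal h = ord0) ?B0 ?eqxx//; apply/val_inj.
rewrite (_ : Ordinal h = lift ord0 ord0); last by apply/val_inj.
by rewrite (negbTE B1).
Qed.

Section cumulant2.
Context {d : measure_display} {T : measurableType d} {R : realType}.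
Variable P : probability T R.

Lemma cumulant2_centered (X : 'I_2 -> T -> R) : Ex P (X ord0) = 0 ->
  cumulant P X = Ex P (fun w => X ord0 w * X (lift ord0 ord0) w).
Proof.
move=> X0; rewrite /cumulant (bigD1 [set [set: 'I_2]]%SET)/=; last first.
  apply/and3P; split.
  - by rewrite /finset.cover big_set1.
  - apply/finset.trivIsetP => A B; rewrite !finset.inE => /eqP -> /eqP ->.
    by rewrite eqxx.
  - rewrite finset.inE; apply/eqP => /finset.setP/(_ ord0).
    by rewrite !finset.inE.
rewrite [X in _ + X]big1 ?addr0; last first.
  move=> Q /andP[/partition_I2[->|Q0]]; first by rewrite eqxx.
  move=> _; rewrite (bigD1 [set ord0]%SET)//=.
  rewrite (_ : Ex _ _ = 0) ?mul0r ?mulr0// -[RHS]X0.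
  by congr Ex; apply/funext => w; rewrite big_set1.
rewrite cards1 /= fact0 ?expr0 !mul1r big_set1.
congr Ex; apply/funext => w.
under eq_bigl do rewrite finset.inE.
by rewrite big_ord_recl big_ord1.
Qed.

Variable Z : int -> T -> R.
Hypothesis hZ : assumptionZ P Z.

(** Cumulant summability for [r = 1], since the second cumulant of the centred process is the
    autocovariance. *)
Lemma autocov_summable : exists2 M : R, 0 <= M &
  forall N, \sum_(l < N) `|autocov P Z (l : nat)%:Z| <= M.
Proof.
have [_ [_ [_ [_ /(_ 1%N isT)[M HM]]]]] := hZ.
exists M; first by apply: le_trans (HM 0%N); exact: sumr_ge0.
move=> N; apply: le_trans (HM N).
rewrite (reindex (fun j : 'I_(N.*2.+1) => [ffun _ : 'I_1 => j])) /=; last first.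
  exists (fun f : {ffun 'I_1 -> 'I_(N.*2.+1)} => f ord0) => [j _|f _].
    by rewrite ffunE.
  by apply/ffunP => x; rewrite ffunE [x]ord1; congr (f _); exact: val_inj.
have E (j : 'I_(N.*2.+1)) :
    cumulant P (Zvec Z (fun l : 'I_1 => ([ffun _ : 'I_1 => j] l : nat)%:Z - N%:Z)) =
    autocov P Z ((j : nat)%:Z - N%:Z).
  rewrite cumulant2_centered /Zvec unlift_none /=; last exact: Ex_Z0.
  by rewrite liftK /= ffunE (autocovE hZ).
under [leRHS]eq_bigr do rewrite E.
rewrite -(big_mkord xpredT (fun l => `|autocov P Z l%:Z|)).
rewrite -(big_mkord xpredT (fun j => `|autocov P Z (j%:Z - N%:Z)|)).
(* Index [N] of the window is lag [0]. Negative lags and the last lag [N] are dropped, leaving lags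
   [0] to [N - 1]. *)
rewrite [leRHS](@big_cat_nat _ _ _ N)/=; [|lia..].
rewrite -[leLHS]add0r; apply: lerD; first exact: sumr_ge0.
rewrite [leRHS](@big_cat_nat _ _ _ N.*2 N)/=; [|lia..].
rewrite -[leLHS]addr0; apply: lerD; last exact: sumr_ge0.
rewrite -addnn -[X in index_iota X (N + N)]add0n big_addn addnK.
by apply: ler_sum => l _; rewrite PoszD addrK.
Qed.

End cumulant2.

(** Pairing lags [l] and [-l] turns the partial sums of the spectral density into [trig_poly]. *)
Lemma sum_symmetric_window (R : zmodType) (F : int -> R) N :
  \sum_(j < N.*2.+1) F ((j : nat)%:Z - N%:Z) =
  F 0 + \sum_(l < N) (F l.+1%:Z + F (- l.+1%:Z)).
Proof.
rewrite -(big_mkord xpredT (fun j => F (j%:Z - N%:Z))).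
rewrite (@big_cat_nat _ _ _ N)/=; [|lia..].
rewrite big_nat_rev -[X in index_iota X N.*2.+1]add0n big_addn.
rewrite (_ : (N.*2.+1 - N = N.+1)%N); last lia.
rewrite big_split/= addrC big_nat_recl// add0n subrr -addrA; congr (_ + (_ + _)).
  rewrite big_mkord; apply: eq_bigr => l _.
  by congr F; rewrite PoszD addrK.
rewrite [LHS]big_nat -(big_mkord xpredT (fun l => F (- l.+1%:Z))) [RHS]big_nat.
apply: eq_bigr => l /andP[_ lN]; congr F; lia.
Qed.

(** * Measurability of events that are open in the matrix entries *)

Section entries.
Context {d : measure_display} {T : measurableType d} {R : realType}.

(* [A] is a countable union of preimages of rational balls.  This is how events
   about eigenvalues are shown to be measurable: the eigenvalue functions
   themselves are not assumed to be. *)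
Lemma measurable_locally_entrywise p (F : T -> 'M[R]_p) (A : set T) :
  (forall i j, measurable_fun setT (fun w => F w i j)) ->
  (forall w, A w -> exists2 e, 0 < e &
     forall w', (forall i j, `|F w i j - F w' i j| < e) -> A w') ->
  measurable A.
Proof.
move=> mF HA.
(* Rational centre and radius give a countable family; [V] keeps the balls contained in [A]. *)
pose U (q : 'M[rat]_p * rat) : set T :=
  [set w | forall i j, `|ratr (q.1 i j) - F w i j| < ratr q.2].
pose V q := if asbool (U q `<=` A) then U q else set0.
suff -> : A = \bigcup_q V q.
  apply: countable_bigcupT_measurable; first exact: countableP.
  move=> q; rewrite /V; case: ifP => // _.
  rewrite (_ : U q = \bigcap_(ij in [set: 'I_p * 'I_p])
    [set w | `|ratr (q.1 ij.1 ij.2) - F w ij.1 ij.2| < ratr q.2]); last first.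
    apply/seteqP; split => [w Uw [i j] _|w Uw i j]; first exact: Uw.
    exact: (Uw (i, j)).
  apply: fin_bigcap_measurable => // -[i j] _ /=.
  rewrite -[X in measurable X]setTI.
  have mG : measurable_fun setT (fun w => `|ratr (q.1 i j) - F w i j|).
    by apply: measurableT_comp => //; apply: measurable_funB => //; exact: measurable_cst.
  have := mG measurableT `]-oo, (ratr q.2 : R)[%classic (measurable_itv _).
  congr measurable; apply/seteqP; split => w /= [_];
    by rewrite /= ?in_itv/=; split; rewrite /= ?in_itv.
apply/seteqP; split => [w Aw|w [q _]]; last first.
  by rewrite /V; case: ifPn => // /asboolP; apply.
have [e e0 He] := HA _ Aw.
(* A radius below [e / 2] puts any two points of one ball at entrywise distance less than [e]. *)
have e20 : 0 < e / 2 by rewrite divr_gt0.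
have [r] := rat_in_itvoo e20; rewrite in_itv/= => /andP[r0 re].
have /fin_all_exists[B HB] : forall ij : 'I_p * 'I_p,
    exists x : rat, `|ratr x - F w ij.1 ij.2| < ratr r :> R.
  move=> ij; have lt : F w ij.1 ij.2 - ratr r < F w ij.1 ij.2 + ratr r by lra.
  have [x] := rat_in_itvoo lt.
  by rewrite in_itv/= => xr; exists x; rewrite ltr_distl.
exists (\matrix_(i, j) B (i, j), r) => //.
rewrite /V; case: ifPn => [_ i j|/asboolP []].
  by rewrite mxE; exact: (HB (i, j)).
move=> w' Uw'; apply: He => i j.
have := Uw' i j; have := HB (i, j); rewrite mxE /= => h1 h2.
have := ler_distD (ratr (B (i, j))) (F w i j) (F w' i j).
rewrite [`|F w i j - ratr _|]distrC; lra.
Qed.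

End entries.

(** * Sums of square-integrable variables, Markov's inequality and the band count *)

Section more_moments.
Context {d : measure_display} {T : measurableType d} {R : realType}.
Variable P : probability T R.

Lemma square_integrableZ a (X : T -> R) : square_integrable P X ->
  square_integrable P (fun w => a * X w).
Proof.
move=> [mX iX]; split.
  by apply: measurable_funM => //; exact: measurable_cst.
have := integrableZR (a ^+ 2) iX.
by congr integrable; apply/funext => w /=; rewrite exprMn.
Qed.

Lemma square_integrable_sum n (X : 'I_n -> T -> R) :
  (forall k, square_integrable P (X k)) -> square_integrable P (fun w => \sum_k X k w).
Proof.
elim: n X => [|n IH] X iX.
  have := square_integrable_cst P 0; congr square_integrable.
  by apply/funext => w; rewrite big_ord0.
have := square_integrableD (iX ord0) (IH _ (fun k => iX (lift ord0 k))).
by congr square_integrable; apply/funext => w; rewrite big_ord_recl.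
Qed.

Lemma markov_inequality (X : T -> R) (a : R) : 0 < a ->
  (forall w, 0 <= X w) -> P.-integrable setT (EFin \o X) ->
  (P [set w | (a <= X w)%R] <= (Ex P X / a)%:E)%E.
Proof.
move=> a0 X0 iX.
have mX : measurable_fun setT X by have /integrableP[/measurable_EFinP] := iX.
have := @markov _ _ _ P (rv_of mX : {RV P >-> R}) id a a0 (@measurable_id _ _ _)
  (fun r h => h) (fun x y _ _ xy => xy).
rewrite unlock /=.
rewrite (_ : [set x | (a%:E <= `|(X x)%:E|)%E] = [set w | a <= X w]); last first.
  by apply/seteqP; split => w /=; rewrite lee_fin ger0_norm.
under eq_integral do rewrite /= ger0_norm//.
by move=> H; rewrite EFinM lee_pdivlMr// muleC fineK//; exact: integrable_fin_num.
Qed.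

End more_moments.

Section band.
Variable R : realType.

Lemma band_row_count p (b : R) (i : 'I_p) : 0 <= b ->
  \sum_(j < p) (`|i%:R - j%:R| <= b :> R)%R%:R <= 2 * (b + 1) :> R.
Proof.
move=> b0.
pose g (k : nat) : R := (k%:R <= b :> R)%R%:R.
under eq_bigr do rewrite normB_gap -/(g _).
apply: le_trans (sum_gap_le i (_ : forall k, 0 <= g k)) _ => //.
rewrite ler_pM2l//.
have /andP[t1 t2] := truncn_itv b0.
apply: (@le_trans _ _ (\sum_(k < p) (k < (Num.truncn b).+1)%N%:R)).
  apply: ler_sum => k _; rewrite /g ler_nat.
  have [kb|] := leP (k%:R : R) b => //.
  by rewrite -(ltr_nat R) (le_lt_trans kb).
by apply: le_trans (sum_lt_le _ _ _) _; rewrite -natr1 lerD2r.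
Qed.

End band.

(** * Banded sample covariance matrices *)

Section banded.
Context {d : measure_display} {T : measurableType d} {R : realType}.
Variable P : probability T R.
Variables (Z : int -> T -> R) (Zc : nat -> int -> T -> R).
Hypotheses (hZ : assumptionZ P Z) (hcop : iid_copies P Z Zc).

Definition acov (k : nat) : R := autocov P Z k%:Z.

Lemma autocov_gap (i j : nat) : autocov P Z (j.+1%:Z - i.+1%:Z) = acov (gap i j).
Proof.
rewrite /acov /gap; have [ij|/ltnW ij] := leqP i j.
  by congr autocov; lia.
by rewrite -(autocovN hZ); congr autocov; lia.
Qed.

Lemma specdens_trig t : specdens P Z t = limn (fun m => trig_poly m acov t).
Proof.
congr (limn _); apply/funext => N.
rewrite (sum_symmetric_window (fun j => autocov P Z j * cos (2 * pi * j%:~R * t)) N).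
rewrite mulr0 mul0r cos0 mulr1; congr (_ + _); apply: eq_bigr => l _.
rewrite (autocovN hZ) rmorphN/= !mulrN mulNr cosN -mulrDr /acov; congr (_ * _).
by rewrite [RHS]mulr_natl mulr2n.
Qed.

(** The entrywise expectation of [Ymat] for [n > 0], a banded Toeplitz matrix. *)
Definition mean_mat (b : R) p : 'M[R]_p :=
  \matrix_(i, j) (if `|i%:R - j%:R| <= b then acov (gap i j) else 0).

Lemma Ymat_sym n b p w i j : Ymat Zc n b p w i j = Ymat Zc n b p w j i.
Proof.
rewrite !mxE distrC; case: ifP => // _.
by apply: eq_bigr => k _; rewrite mulrC.
Qed.

Let mZc i j : measurable_fun setT (Zc i j). Proof. by have [] := hcop. Qed.

Lemma Ymat_entryE n b p (i j : 'I_p) : (fun w => Ymat Zc n b p w i j) =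
  if `|i%:R - j%:R| <= b then
    (fun w => \sum_(k < n) (Zc k.+1 i.+1%:Z w / Num.sqrt n%:R) *
                           (Zc k.+1 j.+1%:Z w / Num.sqrt n%:R))
  else (fun=> 0).
Proof. by apply/funext => w; rewrite mxE; case: ifP. Qed.

Lemma measurable_Ymat n b p i j :
  measurable_fun setT (fun w => Ymat Zc n b p w i j).
Proof.
rewrite Ymat_entryE; case: ifP => _; last exact: measurable_cst.
apply: measurable_sum => k; apply: measurable_funM;
  by apply: measurable_funM => //; exact: measurable_cst.
Qed.

Definition deviation n b p w : R :=
  \sum_i \sum_j (Ymat Zc n b p w i j - mean_mat b p i j) ^+ 2.

Lemma square_integrable_entry n b p i j : (0 < n)%N ->
  square_integrable P (fun w => Ymat Zc n b p w i j - mean_mat b p i j).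
Proof.
move=> n0; apply: square_integrableD; last exact: square_integrable_cst.
rewrite Ymat_entryE; case: ifP => _; last exact: square_integrable_cst.
apply: square_integrable_sum => k.
have [+ _] := square_integrable_mul4 (mZc k.+1 i.+1%:Z) (mZc k.+1 j.+1%:Z)
  (integral_Zc_pow4 hZ hcop _ (ltn0Sn k)) (integral_Zc_pow4 hZ hcop _ (ltn0Sn k)).
move=> /(@square_integrableZ _ _ _ _ n%:R^-1).
congr square_integrable; apply/funext => w.
by rewrite mulrACA -invfM -expr2 sqr_sqrtr ?ler0n// mulrC.
Qed.

Lemma integrable_deviation n b p : (0 < n)%N ->
  P.-integrable setT (EFin \o deviation n b p).
Proof.
move=> n0; apply: integrable_sumR => i; apply: integrable_sumR => j.
by have [] := square_integrable_entry b i j n0.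
Qed.

(** Each of the [p] rows has at most [2 * (b + 1)] entries in the band, with variance at most the
    fourth moment over [n]; outside the band both matrices vanish. *)
Lemma Ex_deviation n b p : (0 < n)%N -> 0 <= b ->
  Ex P (deviation n b p) <= p%:R * (2 * (b + 1) * (fourth_moment P Z / n%:R)).
Proof.
move=> n0 b0.
have i2 i j : P.-integrable setT (EFin \o (fun w => (Ymat Zc n b p w i j - mean_mat b p i j) ^+ 2)).
  by have [] := square_integrable_entry b i j n0.
rewrite Ex_sum; last by move=> i; apply: integrable_sumR.
rewrite mulr_natl -[p in _ *+ p]card_ord -sumr_const.
apply: ler_sum => i _; rewrite Ex_sum//.
have c0 : 0 <= fourth_moment P Z / n%:R.
  rewrite divr_ge0//; rewrite -[leLHS](Ex_cst P).
  apply: Ex_le; first exact: (square_integrable1 (square_integrable_cst P 0)).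
    exact: (integrable_Z0_pow4 hZ).
  by move=> w; rewrite exprn_even_ge0.
apply: le_trans (ler_wpM2r c0 (band_row_count i b0)).
rewrite mulr_suml; apply: ler_sum => j _.
case ijb : (`|i%:R - j%:R| <= b :> R); last first.
  rewrite (_ : (fun _ => _) = (fun=> 0)) ?Ex_cst ?mul0r//.
  by apply/funext => w; rewrite !mxE ijb subr0 expr0n.
rewrite mul1r; apply: le_trans (sample_cov_variance hZ hcop i.+1%:Z j.+1%:Z n0).
rewrite le_eqVlt; apply/orP; left; apply/eqP; congr Ex; apply/funext => w.
by rewrite !mxE ijb autocov_gap.
Qed.

End banded.

(** * Stability and measurability of spectral averages *)

(** Only the eigenvalues of the comparison matrix [B] must be bounded; those of [A] may be listed in
    any order. *)
Lemma eigenvalue_mean_compare (R : realType) p (A B : 'M[R]_p)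
    (lam mu : 'I_p -> R) (f : R -> R) (e K C : R) :
  (0 < p)%N -> (forall i j, A i j = A j i) -> eigenvalue_list A lam ->
  unitarily_diag B mu -> (forall j, `|mu j| <= C) ->
  (forall x y, `|y| <= C -> `|f x - f y| <= e + K * (x - y) ^+ 2) ->
  `|p%:R^-1 * (\sum_i f (lam i)) - p%:R^-1 * \sum_i f (mu i)| <=
    e + K * (p%:R^-1 * \sum_i \sum_j (A i j - B i j) ^+ 2).
Proof.
move=> p0 As lamA muB muC fK.
have p0R : 0 < p%:R :> R by rewrite ltr0n.
have [nu nuA lamnu] := eigenvalues_unitarily_diag As lamA.
rewrite (sum_perm_codom f lamnu) -mulrBr normrM gtr0_norm ?invr_gt0//.
rewrite -(ler_pM2l p0R) mulVKf ?gt_eqF// mulrDr.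
rewrite [X in _ <= _ + X]mulrCA mulVKf ?gt_eqF//.
by apply: unitarily_diag_compare => // i j; exact: fK.
Qed.

Section event.
Context {d : measure_display} {T : measurableType d} {R : realType}.
Variable P : probability T R.
Variables (Z : int -> T -> R) (Zc : nat -> int -> T -> R).
Hypotheses (hcop : iid_copies P Z Zc).

(** The listing [lam] is arbitrary in [w], but the average is symmetric and depends continuously on
    the entries, so the event is open in them. *)
Lemma measurable_spectral_event n b p (lam : T -> 'I_p -> R) (f : R -> R) (M I eps : R) :
  (0 < p)%N -> continuous f -> (forall x, `|f x| <= M) ->
  (forall w, eigenvalue_list (Ymat Zc n b p w) (lam w)) ->
  measurable [set w | eps < `|p%:R^-1 * (\sum_(i < p) f (lam w i)) - I|].
Proof.
move=> p0 fc fM hlam.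
have p0R : 0 < p%:R :> R by rewrite ltr0n.
apply: (@measurable_locally_entrywise _ _ _ p (Ymat Zc n b p)).
  by move=> i j; exact: (measurable_Ymat hcop).
move=> w /= ew.
pose s := `|p%:R^-1 * (\sum_(i < p) f (lam w i)) - I| - eps.
have s0 : 0 < s by rewrite subr_gt0.
have Ys w' i j : Ymat Zc n b p w' i j = Ymat Zc n b p w' j i by exact: Ymat_sym.
have [mu muY lammu] := eigenvalues_unitarily_diag (Ys w) (hlam w).
(* The reference matrix is [Ymat] at [w] itself, so [C] and [K] may depend on [w]. *)
pose C := \sum_j `|mu j|.
have muC j : `|mu j| <= C by rewrite /C (bigD1 j)//= lerDl; exact: sumr_ge0.
have [K K0 fK] := @quadratic_modulus R f M C (s / 4) fc fM ltac:(lra).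
(* [e <= 1] gives [e ^+ 2 <= e], so the quadratic term costs at most [s / 4]; with the modulus the
   average moves by at most [s / 2]. *)
pose e := Num.min 1 (s / (4 * (K + 1) * p%:R)).
have e0 : 0 < e by rewrite lt_min ltr01 divr_gt0// !mulr_gt0// ltr_wpDl.
have e2 : K * (p%:R * e ^+ 2) <= s / 4.
  have e1 : e <= 1 by rewrite ge_min lexx.
  have : e * (4 * (K + 1) * p%:R) <= s.
    by rewrite -ler_pdivlMr ?ge_min ?lexx ?orbT// !mulr_gt0// ltr_wpDl.
  have : 0 <= K * p%:R by rewrite mulr_ge0// ltW.
  move: K0 p0R e0; move: (p%:R : R) => q K0 q0 e0 h1 h2.
  have : e ^+ 2 <= e by rewrite expr2 ler_piMl// ltW.
  have qe : 0 < q * e by rewrite mulr_gt0.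
  nra.
exists e => // w' Hw'.
have := eigenvalue_mean_compare p0 (Ys w') (hlam w') muY muC fK.
rewrite -(sum_perm_codom f lammu).
have : K * (p%:R^-1 * \sum_i \sum_j (Ymat Zc n b p w' i j - Ymat Zc n b p w i j) ^+ 2) <= s / 4.
  apply: le_trans e2; rewrite ler_wpM2l// ler_pdivrMl//.
  have -> : p%:R * (p%:R * e ^+ 2) = \sum_(i < p) \sum_(j < p) e ^+ 2.
    by rewrite !sumr_const !card_ord !mulr_natl.
  apply: ler_sum => i _; apply: ler_sum => j _.
  rewrite -[leLHS]real_normK ?num_real// ler_sqr ?nnegrE ?(ltW e0)//.
  by rewrite distrC; exact/ltW/Hw'.
move: ew; rewrite /s.
set x := p%:R^-1 * \sum_(i < p) f (lam w' i).
set y := p%:R^-1 * \sum_(i < p) f (lam w i).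
move=> ew h1 h2; have := ler_distD x y I; rewrite [`|y - x|]distrC; lra.
Qed.

End event.

(** * Convergence of spectral averages in probability *)

Theorem theorem2p3
  (d : measure_display) (T : measurableType d) (R : realType)
  (P : probability T R)
  (Z : int -> T -> R) (Zc : nat -> int -> T -> R)
  (n : nat -> nat) (b : nat -> R)
  (* Assumption A *)
  (hn : forall p : nat, (0 < p)%N -> (0 < n p)%N)
  (hb : forall p : nat, (0 < p)%N -> 0 < b p)
  (hbp : forall p : nat, (0 < p)%N -> b p <= p%:R)
  (hbinf : b @ \oo --> +oo)
  (hninf : (fun p => (n p)%:R : R) @ \oo --> +oo)
  (hbn : (fun p => b p / (n p)%:R) @ \oo --> 0)
  (* Assumption Z, and i.i.d. copies *)
  (hZ : assumptionZ P Z)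
  (hcop : iid_copies P Z Zc) :
  (* weak convergence of L^(p) to nu_Z in probability *)
  forall (f : R -> R), continuous f -> (exists M : R, forall x, `|f x| <= M) ->
  forall eps : R, 0 < eps ->
  forall lam : forall p : nat, T -> 'I_p -> R,
    (forall (p : nat) (w : T), (0 < p)%N ->
       eigenvalue_list (Ymat Zc (n p) (b p) p w) (lam p w)) ->
    (fun p : nat =>
       P [set w | eps < `| (p%:R)^-1 * (\sum_(i < p) f (lam p w i))
                           - nuZ_int P Z f |] ) @ \oo --> 0%E.
Proof.
move=> f fc [M fM] eps eps0 lam hlam.
pose r := acov P Z.
have [Mr Mr0 hr] : exists2 Mr, 0 <= Mr & forall N, \sum_(l < N) `|r l| <= Mr.
  exact: autocov_summable hZ.
pose I := nuZ_int P Z f.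
pose c4 := fourth_moment P Z.
(* The range [2 * Mr] is uniform in [m], so [K] is fixed before [m]. The allowance [eps] is split
   into [eps / 8] for the modulus, [5 eps / 8] for the matrix distance, [eps / 8] for the Riemann
   sum and [eps / 8] for truncating the Fourier series. *)
have [K K0 fK] := @quadratic_modulus R f M (2 * Mr) (eps / 8) fc fM ltac:(lra).
pose tau := eps / (64 * (K + 1)).
have K1 : 0 < K + 1 by rewrite ltr_wpDl.
have tau0 : 0 < tau by rewrite divr_gt0// mulr_gt0.
have Ktau : K * tau <= eps / 64.
  suff : 64 * (K * tau + tau) = eps by lra.
  by rewrite /tau; field; rewrite gt_eqF.
(* The truncation order [m] is fixed once and for all; only then does [p] grow. *)
have [m [Hm1 Hm2]] : exists m,
    `|\int[lebesgue_measure]_(t in `[0, 1]) f (trig_poly m r t) - I| <= eps / 8 /\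
    forall p, \sum_(d < p) (m < d)%N%:R * r d ^+ 2 <= tau.
  have h1 := integral_trig_poly_cvg hr fc fM.
  have h2 := sqr_tail_small hr tau0.
  move/cvgrPdist_le : h1 => /(_ (eps / 8) ltac:(lra)) h1.
  have [N _ HN] := filterI h1 h2.
  exists N; have [H1 H2] := HN N (leqnn N); split => //.
  rewrite distrC; rewrite /I /nuZ_int.
  by under eq_integral do rewrite (specdens_trig hZ).
have gc : continuous (f \o trig_poly m r).
  by move=> t; apply: continuous_comp; [exact: trig_poly_continuous|exact: fc].
have rs := riemann_sum_cvg gc (fun t => fM (trig_poly m r t)).
move/cvgrPdist_le : rs => /(_ (eps / 8) ltac:(lra)) Hrs.
pose delta := eps / (8 * (K + 1)).
have delta0 : 0 < delta by rewrite divr_gt0// mulr_gt0.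
(* Markov's bound for [deviation >= p * delta]; the factor [p] cancels. *)
pose ub p := 2 * (b p + 1) * (c4 / (n p)%:R) / delta.
have ub0 : (fun p => (ub p)%:E) @ \oo --> 0%E.
  apply: cvg_EFin; first exact: nearW.
  have nV : (fun p => (n p)%:R^-1 : R) @ \oo --> (0 : R).
    apply/gtr0_cvgV0; last exact: hninf.
    by exists 1%N => // p /= p0; rewrite ltr0n hn.
  (* The [+ 1] of the band count leaves a term [1 / n], which vanishes because [n] tends to
     infinity. *)
  have -> : fine \o (fun p => (ub p)%:E) =
      (fun p => 2 * c4 / delta * (b p / (n p)%:R + (n p)%:R^-1)).
    by apply/funext => p /=; rewrite /ub; ring.
  rewrite [X in _ --> X](_ : _ = 2 * c4 / delta * (0 + 0)); last by rewrite addr0 mulr0.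
  by apply: cvgM; [exact: cvg_cst|exact: cvgD].
apply: (@squeeze_cvge _ _ _ _ (cst 0%E) _ (fun p => (ub p)%:E)) => //; last exact: cvg_cst.
near=> p.
have p0 : (0 < p)%N by near: p; exact: nbhs_infty_gt.
have mp : (2 * m < p)%N by near: p; exact: nbhs_infty_gt.
have mb : m%:R <= b p by near: p; move/cvgryPge: hbinf; apply.
have pbig : 4 * Mr ^+ 2 * m%:R ^+ 2 / tau <= p%:R by near: p; exact: nbhs_infty_ger.
have Hp : `|\int[lebesgue_measure]_(t in `[0, 1]) (f \o trig_poly m r) t -
   p%:R^-1 * \sum_(k < p) (f \o trig_poly m r) (k%:R / p%:R)| <= eps / 8 by near: p.
have p0R : 0 < p%:R :> R by rewrite ltr0n.
rewrite measure_ge0/=.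
have n0 := hn p p0.
(* The spectral event is contained in a large-deviation event for the Hilbert-Schmidt distance to
   the mean. *)
apply: (@le_trans _ _ (P [set w | (p%:R * delta <= deviation P Z Zc (n p) (b p) p w)%R])); last first.
  have dev0 w : 0 <= deviation P Z Zc (n p) (b p) p w.
    by apply: sumr_ge0 => i _; apply: sumr_ge0 => j _; exact: sqr_ge0.
  have pd0 : 0 < p%:R * delta by rewrite mulr_gt0.
  apply: (le_trans (markov_inequality pd0 dev0 (integrable_deviation hZ hcop (b p) p n0))).
  rewrite lee_fin ler_pdivrMr//.
  have -> : ub p * (p%:R * delta) = p%:R * (2 * (b p + 1) * (c4 / (n p)%:R)).
    by rewrite mulrCA /ub divfK// gt_eqF.
  by apply: (Ex_deviation hZ hcop) => //; exact/ltW/hb.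
apply: le_measure.
- rewrite inE; apply: (measurable_spectral_event hcop) => // w.
  exact: hlam.
- rewrite inE.
  have := integrable_deviation hZ hcop (b p) p n0 => /integrableP[/measurable_EFinP mdev _].
  have := mdev measurableT `[p%:R * delta, +oo[%classic (measurable_itv _).
  congr measurable; apply/seteqP; split => w /=; rewrite in_itv/= andbT; [by case|by split].
(* By contradiction: a small deviation forces the average to within [eps] of the limit. *)
move=> w /= ew; rewrite leNgt; apply/negP => devw.
pose mu (k : 'I_p) := trig_poly m r (k%:R / p%:R).
have muC k : `|mu k| <= 2 * Mr by exact: trig_poly_bound.
have H := eigenvalue_mean_compare p0 (Ymat_sym Zc (n p) (b p) w) (hlam p w p0)
   (circulant_unitarily_diag p0 m r) muC fK.
have dist : \sum_i \sum_j (Ymat Zc (n p) (b p) p w i j - circulant p m r i j) ^+ 2 <=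
  2 * deviation P Z Zc (n p) (b p) p w + 2 * (4 * p%:R * tau + 4 * Mr ^+ 2 * m%:R ^+ 2).
  apply: (@le_trans _ _ (2 * deviation P Z Zc (n p) (b p) p w +
     2 * \sum_i \sum_j (mean_mat P Z (b p) p i j - circulant p m r i j) ^+ 2)).
    rewrite /deviation !mulr_sumr -big_split/=; apply: ler_sum => i _.
    rewrite !mulr_sumr -big_split/=; apply: ler_sum => j _.
    set x := Ymat _ _ _ _ _ _ _; set y := mean_mat _ _ _ _ _ _; set z := circulant _ _ _ _ _.
    have := sqr_ge0 (x - y - (y - z)); nra.
  rewrite lerD2l ler_pM2l//.
  have := toeplitz_circulant_dist mp mb (summable_coef_le hr).
  under eq_bigr do under eq_bigr do rewrite -/(r _).
  move=> h; apply: le_trans (le_trans h _).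
    by apply: ler_sum => i _; apply: ler_sum => j _; rewrite mxE.
  by rewrite lerD2r ler_wpM2l// mulr_ge0.
have {}pbig : 4 * Mr ^+ 2 * m%:R ^+ 2 <= p%:R * tau by rewrite -ler_pdivrMr.
(* [2 * delta] comes from the deviation, [8 * tau] from the tail of squares and [2 * tau] from the
   corner blocks through [pbig]. *)
have {}dist : p%:R^-1 * \sum_i \sum_j (Ymat Zc (n p) (b p) p w i j - circulant p m r i j) ^+ 2 <=
   2 * delta + 10 * tau.
  by rewrite ler_pdivrMl//; lra.
have : K * (2 * delta + 10 * tau) <= eps * (5 / 8).
  have Kd : K * delta <= eps / 8.
    suff : 8 * (K * delta + delta) = eps by lra.
    by rewrite /delta; field; rewrite gt_eqF.
  lra.
have := ler_wpM2l K0 dist.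
move: H ew Hp Hm1; rewrite /mu /=.
(* The chain runs from the eigenvalues of [Ymat] to those of the circulant, to the integral for
   [trig_poly], to [I]; the errors add up to at most [eps], against the strict inequality [ew]. *)
set a1 := p%:R^-1 * _; set a2 := p%:R^-1 * _; set a3 := Rintegral _ _ _.
have := ler_distD a2 a1 I; have := ler_distD a3 a2 I; rewrite [`|a3 - a2|]distrC.
lra.
Unshelve. all: by end_near. Qed.
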